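(* (a) The pair $(\mathrm{udr},\mathrm{des})$ is shuffle-compatible. (b) The linear map on $\mathcal{A}_{(\mathrm{udr},\mathrm{des})}$ defined by $[\pi]\mapsto\frac{N_\pi}{(1-t)(1-t^2)^{|\pi|}}x^{|\pi|}$ if $|\pi|\ge1$ and $[\pi]\mapsto1/(1-t)$ if $|\pi|=0$, where, writing $u=\mathrm{udr}(\pi)$ and $d=\mathrm{des}(\pi)$, $N_\pi=t^{u}(1+y)^{u-1}(1+yt^2)^{|\pi|-d-\lceil u/2\rceil}(y+t^2)^{d-\lfloor u/2\rfloor}(1+yt)^{\lceil u/2\rceil-\lfloor u/2\rfloor}(y+t)^{1-\lceil u/2\rceil+\lfloor u/2\rfloor}$, is a $\mathbb{Q}$-algebra isomorphism from $\mathcal{A}_{(\mathrm{udr},\mathrm{des})}$ to the span of $\{\frac1{1-t}\}\cup\{\frac{t(1+yt)(1+yt^2)^{n-1}}{(1-t)(1-t^2)^n}x^n\}_{n\ge1}\cup\{\frac{t^j(1+y)^{j-1}(1+yt^2)^{n-k-\lceil j/2\rceil}(y+t^2)^{k-\lfloor j/2\rfloor}S_j}{(1-t)(1-t^2)^n}x^n\}_{n\ge1,\,2\le j\le n,\,\lfloor j/2\rfloor\le k\le n-\lceil j/2\rceil}$, where $S_j=1+yt$ if $j$ is odd and $S_j=y+t$ if $j$ is even; this span is a subalgebra of $\mathbb{Q}[[t*]][x,y]$. (c) The $n$th homogeneous component of $\mathcal{A}_{(\mathrm{udr},\mathrm{des})}$ has dimension $\binom n2+1$.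
   Context: A permutation of length $n$ is a sequence $\pi=\pi_1\cdots\pi_n$ of distinct positive integers. $\mathrm{des}(\pi)$ is the number of $i\in[n-1]$ with $\pi_i>\pi_{i+1}$. A birun of $\pi$ is a maximal monotone consecutive subsequence; an up-down run of $\pi$ is either a birun or the single letter $\pi_1$ when $\pi_1>\pi_2$; $\mathrm{udr}(\pi)$ is the number of up-down runs. For disjoint permutations, $S(\pi,\sigma)$ is the set of shuffles (permutations of length $|\pi|+|\sigma|$ containing both as subsequences). A statistic $\mathrm{st}$ is shuffle-compatible if for disjoint $\pi,\sigma$ the multiset $\{\mathrm{st}(\tau):\tau\in S(\pi,\sigma)\}$ depends only on $\mathrm{st}(\pi),\mathrm{st}(\sigma),|\pi|,|\sigma|$; its shuffle algebra $\mathcal{A}_{\mathrm{st}}$ has basis the classes $[\pi]$ of permutations with equal length and $\mathrm{st}$-value, product $[\pi][\sigma]=\sum_{\tau\in S(\pi,\sigma)}[\tau]$, graded by length. $\mathbb{Q}[[t*]][x,y]$ denotes polynomials in $x,y$ with coefficients formal power series in $t$, with multiplication ordinary in $x,y$ and the Hadamard product $(\sum a_nt^n)*(\sum b_nt^n)=\sum a_nb_nt^n$ in $t$. *)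

(* Defs.v *)
From HB Require Import structures.
From mathcomp Require Import all_boot all_order all_algebra.
From mathcomp Require Import finmap generic_quotient monalg.
From mathcomp Require Import mathcomp_extra boolp classical_sets functions.

Set Implicit Arguments.
Unset Strict Implicit.
Unset Printing Implicit Defensive.

Import GRing.Theory.

Local Open Scope classical_set_scope.
Local Open Scope quotient_scope.
Local Open Scope ring_scope.

Section Span.
Variables (K : fieldType) (V : lmodType K).
Implicit Types S W : set V.

Definition lin_span S : set V :=
  [set v | exists s : seq (K * V),
     (forall p, p \in s -> S p.2) /\ v = \sum_(p <- s) p.1 *: p.2].

Definition has_dimension W (n : nat) : Prop :=
  exists b : 'I_n -> V,
    (forall c : 'I_n -> K, \sum_i c i *: b i = 0 -> forall i, c i = 0) /\
    W = lin_span (range b).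

End Span.

Record permutation := Permutation {
  letters :> seq nat;
  lettersP : uniq letters && all (ltn 0) letters }.

HB.instance Definition _ := [isSub for letters].
HB.instance Definition _ := [Choice of permutation by <:].

Definition disjoint_perms (p q : permutation) := ~~ has [in letters p] q.

(* As p and q are disjoint, a word of length |p| + |q| with distinct letters
   containing both is a rearrangement of p ++ q; see mem_shuffles below. *)
Definition shuffles (p q : permutation) : seq permutation :=
  pmap insub [seq s <- permutations (p ++ q) | subseq p s && subseq q s].

Lemma perm_uniq_letters (p : permutation) : uniq p.
Proof. by case/andP: (lettersP p). Qed.
#[local] Hint Resolve perm_uniq_letters : core.

Lemma letters_gt0 (p : permutation) : all (ltn 0) p.
Proof. by case/andP: (lettersP p). Qed.

Lemma letter_gt0 (p : permutation) x : x \in letters p -> (0 < x)%N.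
Proof. by move=> xp; have := allP (letters_gt0 p) x xp. Qed.

Lemma disjoint_permsC p q : disjoint_perms p q = disjoint_perms q p.
Proof. by rewrite /disjoint_perms has_sym. Qed.

Lemma uniq_cat_perms (p q : permutation) : disjoint_perms p q -> uniq (p ++ q).
Proof. by move=> pq; rewrite cat_uniq; apply/and3P; split. Qed.

Lemma shuffles_uniq p q : uniq (shuffles p q).
Proof.
by apply: (pmap_uniq (insubK _)); rewrite filter_uniq // permutations_uniq.
Qed.

Lemma mem_shufflesE p q t : (t \in shuffles p q) =
  [&& perm_eq t (p ++ q), subseq p t & subseq q t].
Proof.
by rewrite mem_pmap_sub /= mem_filter mem_permutations andbC andbA.
Qed.

Lemma mem_shuffles p q t : disjoint_perms p q ->
  (t \in shuffles p q) =
  [&& size t == (size p + size q)%N, subseq p t & subseq q t].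
Proof.
move=> pq; rewrite mem_shufflesE; apply/idP/idP => /and3P[h pt qt].
  by rewrite pt qt (perm_size h) size_cat eqxx.
rewrite pt qt !andbT perm_sym.
have sub : {subset letters p ++ letters q <= letters t}.
  by move=> x; rewrite mem_cat => /orP[]; apply: mem_subseq.
have [|_ eqt] := uniq_min_size (uniq_cat_perms pq) sub.
  by rewrite size_cat (eqP h).
by apply: uniq_perm => //; apply: uniq_cat_perms.
Qed.

Definition order_iso (p q : seq nat) : Prop :=
  size p = size q /\
  forall i j, (i < size p)%N -> (j < size p)%N ->
    (nth 0 p i < nth 0 p j)%N = (nth 0 q i < nth 0 q j)%N.

(* A permutation statistic depends only on the relative order of the letters;
   this is what makes two classes always have disjoint representatives. *)
Record statistic (T : eqType) := Statistic {
  stat :> permutation -> T;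
  statP : forall p q : permutation, order_iso p q -> stat p = stat q }.

Definition shuffle_compatible (T : eqType) (st : statistic T) : Prop :=
  forall p q p' q' : permutation,
    disjoint_perms p q -> disjoint_perms p' q' ->
    size p = size p' -> size q = size q' -> st p = st p' -> st q = st q' ->
    perm_eq [seq st t | t <- shuffles p q] [seq st t | t <- shuffles p' q'].

Section StatClass.
Variables (T : eqType) (st : statistic T).

Definition st_equiv (p q : permutation) := (size p == size q) && (st p == st q).

Lemma st_equiv_is_equiv : equiv_class_of st_equiv.
Proof.
split=> [p|p q|q p r]; rewrite /st_equiv ?eqxx //.
  by rewrite (eq_sym (size p)) (eq_sym (st p)).
by case/andP=> /eqP-> /eqP->.
Qed.

Definition st_equiv_rel := EquivRelPack st_equiv_is_equiv.

Definition st_class : Type := {eq_quot st_equiv_rel}.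
HB.instance Definition _ := Choice.on st_class.

Definition class_of (p : permutation) : st_class := \pi_{eq_quot st_equiv_rel} p.

Definition class_repr (c : st_class) : permutation :=
  repr (c : {eq_quot st_equiv_rel}).

Lemma class_reprK c : class_of (class_repr c) = c.
Proof. exact: (@reprK _ {eq_quot st_equiv_rel}). Qed.

Lemma class_ofP p q :
  class_of p = class_of q <-> size p = size q /\ st p = st q.
Proof.
split=> [/eqquotP/andP[/eqP-> /eqP->]//|[ps pt]].
by apply/eqquotP; rewrite /= /st_equiv ps pt !eqxx.
Qed.

Lemma class_repr_of p :
  size (class_repr (class_of p)) = size p /\ st (class_repr (class_of p)) = st p.
Proof. by apply/class_ofP; rewrite class_reprK. Qed.

End StatClass.

(* Relabels q above all the letters of p, so as to make it disjoint from p. *)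
Lemma raise_subproof (m : nat) (q : permutation) :
  uniq (map (addn m) q) && all (ltn 0) (map (addn m) q).
Proof.
rewrite (map_inj_uniq (@addnI m)) perm_uniq_letters /=.
apply/allP=> x /mapP[y yq ->] /=.
by rewrite addn_gt0 (letter_gt0 yq) orbT.
Qed.

Definition raise m q := Permutation (raise_subproof m q).

Lemma size_raise m q : size (raise m q) = size q.
Proof. by rewrite size_map. Qed.

Lemma raise_iso m q : order_iso (raise m q) q.
Proof.
split=> [|i j]; rewrite size_map // => iq jq.
by rewrite !(nth_map 0%N) // ltn_add2l.
Qed.

Lemma raise_disjoint (p q : permutation) m :
  (forall x, x \in letters p -> (x <= m)%N) -> disjoint_perms p (raise m q).
Proof.
move=> pm; apply/hasPn=> x /mapP[y yq ->]; apply/negP=> /pm.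
by rewrite -{2}[m]addn0 leq_add2l leqNgt (letter_gt0 yq).
Qed.

Definition max_letter (p : permutation) := foldr maxn 0%N p.

Lemma max_letterP (p : permutation) x : x \in letters p -> (x <= max_letter p)%N.
Proof.
rewrite /max_letter; elim: (letters p) => //= y s IHs; rewrite inE leq_max.
by case/orP=> [/eqP->|/IHs->]; rewrite ?leqnn ?orbT.
Qed.

Section LinearExtension.
Variables (K : choiceType) (V : lmodType rat).
Implicit Types (f : K -> V) (g : {malg rat[K]}).

Definition lin_ext f g : V := \sum_(k <- msupp g) g@_k *: f k.

Lemma lin_extEw f g (d : {fset K}) : (msupp g `<=` d)%fset ->
  lin_ext f g = \sum_(k <- d) g@_k *: f k.
Proof.
move=> gd; rewrite /lin_ext (big_fset_incl _ gd) // => k _ /mcoeff_outdom->.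
by rewrite scale0r.
Qed.

Lemma lin_ext_is_linear f : linear (lin_ext f).
Proof.
move=> a g h; set d := (msupp (a *: g + h) `|` msupp g `|` msupp h)%fset.
have d1 : (msupp (a *: g + h) `<=` d)%fset by rewrite /d -fsetUA fsubsetUl.
have d2 : (msupp g `<=` d)%fset by rewrite fsubsetU // fsubsetUr.
have d3 : (msupp h `<=` d)%fset by rewrite fsubsetUr.
rewrite (lin_extEw _ d1) (lin_extEw _ d2) (lin_extEw _ d3).
rewrite scaler_sumr -big_split; apply: eq_bigr => k _ /=.
by rewrite mcoeffD mcoeffZ scalerDl scalerA.
Qed.

HB.instance Definition _ f :=
  GRing.isLinear.Build rat {malg rat[K]} V *:%R (lin_ext f) (lin_ext_is_linear f).

Lemma lin_extU f k : lin_ext f << k >> = f k.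
Proof.
rewrite (@lin_extEw _ _ [fset k]%fset) ?msuppU_le //.
by rewrite big_seq_fset1 mcoeffUU scale1r.
Qed.

Lemma malg_ext (F G : {malg rat[K]} -> V) : linear F -> linear G ->
  (forall k, F << k >> = G << k >>) -> F =1 G.
Proof.
move=> linF linG FG g.
pose lF := GRing.isLinear.Build rat {malg rat[K]} V *:%R F linF.
pose lG := GRing.isLinear.Build rat {malg rat[K]} V *:%R G linG.
pose F' : {linear {malg rat[K]} -> V} := HB.pack F lF.
pose G' : {linear {malg rat[K]} -> V} := HB.pack G lG.
rewrite -[F]/(F' : _ -> _) -[G]/(G' : _ -> _).
rewrite (monalgE g) !linear_sum; apply: eq_bigr => k _.
have -> : << g@_k *g k >> = g@_k *: << k >> :> {malg rat[K]}.
  by apply/malgP=> k'; rewrite mcoeffZ !mcoeffU mulrnAr mulr1.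
by rewrite !linearZ /= FG.
Qed.

End LinearExtension.

Section ShuffleProduct.
Variables (T : eqType) (st : statistic T).
Local Notation cls := (class_of st).
Local Notation M := {malg rat[st_class st]}.

Definition smul_class (c c' : st_class st) : M :=
  let p := class_repr c in
  let q := raise (max_letter p) (class_repr c') in
  \sum_(t <- shuffles p q) << cls t >>.

Definition smul (g h : M) : M := lin_ext (fun c => lin_ext (smul_class c) h) g.

Lemma empty_subproof : uniq (Nil nat) && all (ltn 0) [::]. Proof. by []. Qed.
Definition empty_perm := Permutation empty_subproof.

Definition sone : M := << cls empty_perm >>.

Lemma smul_linl h : linear (smul^~ h).
Proof. by move=> a g g'; rewrite /smul linearP. Qed.

Lemma smulE g h : smul g h =
  \sum_(k <- msupp g) \sum_(l <- msupp h) (g@_k * h@_l) *: smul_class k l.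
Proof.
apply: eq_bigr => k _; rewrite scaler_sumr; apply: eq_bigr => l _.
by rewrite scalerA.
Qed.

Lemma class_raise m q : cls (raise m q) = cls q.
Proof.
by apply/class_ofP; split; [exact: size_raise | exact/statP/raise_iso].
Qed.

Lemma size_shuffle p q t : t \in shuffles p q -> size t = (size p + size q)%N.
Proof.
by rewrite mem_shufflesE => /andP[/perm_size->]; rewrite size_cat.
Qed.

Lemma shufflesC p q : perm_eq (shuffles p q) (shuffles q p).
Proof.
apply: uniq_perm; rewrite ?shuffles_uniq // => t.
by rewrite !mem_shufflesE [_ && subseq q t]andbC perm_sym perm_catC perm_sym.
Qed.

Definition shuffles3 (p q r : permutation) : seq permutation :=
  pmap insub [seq s <- permutations (p ++ q ++ r) |
                [&& subseq p s, subseq q s & subseq r s]].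

Lemma mem_shuffles3 p q r t : (t \in shuffles3 p q r) =
  [&& perm_eq t (p ++ q ++ r), subseq p t, subseq q t & subseq r t].
Proof. by rewrite mem_pmap_sub /= mem_filter mem_permutations andbC. Qed.

Lemma shuffles3_rot p q r : perm_eq (shuffles3 p q r) (shuffles3 q r p).
Proof.
apply: uniq_perm => [||t].
- by apply: (pmap_uniq (insubK _)); rewrite filter_uniq // permutations_uniq.
- by apply: (pmap_uniq (insubK _)); rewrite filter_uniq // permutations_uniq.
have cat_rot : perm_eq (p ++ q ++ r) (q ++ r ++ p) by rewrite perm_catC catA.
rewrite !mem_shuffles3 (permPr cat_rot).
by case: (subseq p t) (subseq q t) (subseq r t) => [] [] [].
Qed.

Lemma shuffles_disjoint p q r t : disjoint_perms p r -> disjoint_perms q r ->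
  t \in shuffles p q -> disjoint_perms t r.
Proof.
rewrite mem_shufflesE /disjoint_perms => pr qr /andP[/perm_mem ptq _].
apply/hasPn=> x xr; apply/negP; rewrite /= ptq mem_cat => /orP[xp|xq].
  by case/hasP: pr; exists x.
by case/hasP: qr; exists x.
Qed.

Lemma subseq_filter_perm (p : permutation) (a : pred nat) (s : seq nat) :
  {in letters p, forall x, a x} -> subseq p s -> subseq p (filter a s).
Proof. by move=> /allP pa ps; rewrite subseq_filter pa. Qed.

Lemma shuffles_triple (V : nmodType) (G : permutation -> V) p q r :
  disjoint_perms p q -> disjoint_perms p r -> disjoint_perms q r ->
  \sum_(t <- shuffles p q) \sum_(u <- shuffles t r) G u =
  \sum_(u <- shuffles3 p q r) G u.
Proof.
move=> pq pr qr.
have part (t u : permutation) : t \in shuffles p q -> u \in shuffles t r ->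
    letters t = filter [in p ++ q] u.
  rewrite !mem_shufflesE => /andP[/perm_mem tpq _] /and3P[_ tu _].
  rewrite {1}((subseq_uniqP (perm_uniq_letters u)) tu).
  by apply: eq_filter => x; rewrite /= tpq.
rewrite -(big_allpairs_dep (h := fun (_ u : permutation) => u) (F := G)).
apply: perm_big.
apply: uniq_perm => [||u].
- apply: allpairs_uniq_dep; rewrite ?shuffles_uniq //.
    by move=> t _; exact: shuffles_uniq.
  move=> _ _ /allpairsPdep[t [u [tpq utr ->]]] /allpairsPdep[t' [u' [tpq' utr' ->]]].
  rewrite /= => uu'; move: utr'; rewrite -uu' => utr'.
  have -> // : t = t'.
  by apply: val_inj; rewrite /= (part _ _ tpq utr) (part _ _ tpq' utr').
- by apply: (pmap_uniq (insubK _)); rewrite filter_uniq // permutations_uniq.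
apply/allpairsPdep/idP => [[t [u' [tpq utr ->]]]|].
  move: tpq utr; rewrite !mem_shufflesE mem_shuffles3.
  case/and3P=> tpq pt qt /and3P[utr tu ->].
  rewrite (subseq_trans pt tu) (subseq_trans qt tu) !andbT.
  by rewrite (permPl utr) catA perm_cat2r.
rewrite mem_shuffles3 catA => /and4P[ueq pu qu ru].
pose s := filter [in p ++ q] u.
have sP : uniq s && all (ltn 0) s.
  rewrite filter_uniq //=; apply/allP=> x; rewrite mem_filter => /andP[_].
  exact: letter_gt0.
have eqs : perm_eq s (p ++ q).
  rewrite /s; have /(perm_filter [in p ++ q])/permPl-> := ueq.
  rewrite filter_cat (_ : filter _ (p ++ q) = p ++ q); last first.
    by apply/all_filterP/allP=> x.
  rewrite (_ : filter _ r = [::]) ?cats0 //.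
  apply/eqP; rewrite -(negbK (_ == _)) -has_filter; apply/hasPn=> x xr /=.
  rewrite mem_cat negb_or (hasPn pr) ?(hasPn qr) //.
exists (Permutation sP), u; split=> //; rewrite mem_shufflesE /=.
  rewrite eqs !subseq_filter_perm // => x xs; rewrite /= mem_cat xs ?orbT //.
by rewrite ru filter_subseq (permPl ueq) perm_cat2r perm_sym eqs.
Qed.

Hypothesis sc : shuffle_compatible st.

(* The product of two classes can be computed on any disjoint representatives. *)
Lemma smulUU p q : disjoint_perms p q ->
  smul << cls p >> << cls q >> = \sum_(t <- shuffles p q) << cls t >>.
Proof.
move=> pq; rewrite /smul !lin_extU /smul_class.
set p' := class_repr _; set q0 := class_repr _; set q' := raise _ _.
have [szp stp] := class_repr_of st p; have [szq stq] := class_repr_of st q.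
have pq' : disjoint_perms p' q'.
  by apply: raise_disjoint => x; exact: max_letterP.
have /class_ofP[szq' stq'] : cls q' = cls q by rewrite class_raise class_reprK.
have eqst := sc pq' pq szp szq' stp stq'.
pose n := (size p + size q)%N.
pose G x := cls (xget empty_perm [set t : permutation | size t = n /\ st t = x]).
have GP (t : permutation) : size t = n -> cls t = G (st t).
  move=> tn; apply/class_ofP.
  by case: xgetP => [u _ [-> ->]|/(_ t)[]].
have mapG (a b : permutation) : size a = size p -> size b = size q ->
    [seq cls t | t <- shuffles a b] = map G [seq st t | t <- shuffles a b].
  move=> ap bq; rewrite -map_comp; apply/eq_in_map => t /size_shuffle tn /=.
  by apply: GP; rewrite tn ap bq.
rewrite -2!(big_map cls xpredT (fun c => << c >>)); apply: perm_big.
by rewrite !mapG //; apply: perm_map.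
Qed.

Lemma smulC : commutative smul.
Proof.
move=> g h; rewrite !smulE exchange_big; apply: eq_bigr => k _ /=.
apply: eq_bigr => l _; rewrite mulrC; congr (_ *: _).
have smulU c c' : smul_class c c' = smul << c >> << c' >> :> M.
  by rewrite /smul !lin_extU.
rewrite !smulU -(class_reprK k) -(class_raise (max_letter (class_repr l))).
rewrite -(class_reprK l); set p := class_repr _; set q := raise _ _.
have pq : disjoint_perms p q.
  by apply: raise_disjoint => x; rewrite class_reprK; exact: max_letterP.
rewrite !smulUU //; last by rewrite disjoint_permsC.
exact/perm_big/shufflesC.
Qed.

Lemma smul_linr g : linear (smul g).
Proof. by move=> a h h'; rewrite !(smulC g) smul_linl. Qed.

Lemma smul_suml (I : Type) (s : seq I) (F : I -> M) h :
  smul (\sum_(i <- s) F i) h = \sum_(i <- s) smul (F i) h.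
Proof. by rewrite /smul linear_sum. Qed.

Lemma smul_triple p q r :
  disjoint_perms p q -> disjoint_perms p r -> disjoint_perms q r ->
  smul (smul << cls p >> << cls q >>) << cls r >> =
  \sum_(u <- shuffles3 p q r) << cls u >>.
Proof.
move=> pq pr qr; rewrite smulUU // smul_suml -shuffles_triple //.
rewrite !big_seq; apply: eq_bigr => t tpq; apply: smulUU.
exact: shuffles_disjoint tpq.
Qed.

Lemma smulA : associative smul.
Proof.
move=> g h k; move: g; apply: malg_ext.
- exact: smul_linl.
- by move=> a g g'; rewrite !smul_linl.
move=> c1; move: h; apply: malg_ext.
- by move=> a g g'; rewrite smul_linl smul_linr.
- by move=> a g g'; rewrite smul_linr smul_linl.
move=> c2; move: k; apply: malg_ext.
- by move=> a g g'; rewrite !smul_linr.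
- exact: smul_linr.
move=> c3.
pose p := class_repr c1; pose q := raise (max_letter p) (class_repr c2).
pose r := raise (max_letter p + max_letter q) (class_repr c3).
have -> : c1 = cls p by rewrite class_reprK.
have -> : c2 = cls q by rewrite class_raise class_reprK.
have -> : c3 = cls r by rewrite class_raise class_reprK.
have pq : disjoint_perms p q.
  by apply: raise_disjoint => x; exact: max_letterP.
have pr : disjoint_perms p r.
  apply: raise_disjoint => x /max_letterP /leq_trans; apply.
  exact: leq_addr.
have qr : disjoint_perms q r.
  apply: raise_disjoint => x /max_letterP /leq_trans; apply.
  exact: leq_addl.
have qp : disjoint_perms q p by rewrite disjoint_permsC.
have rp : disjoint_perms r p by rewrite disjoint_permsC.
clearbody p q r.
apply: (etrans (smulC _ _)).
apply: (etrans (smul_triple qr qp rp)).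
apply: (etrans _ (esym (smul_triple pq pr qr))).
by apply/esym/perm_big/shuffles3_rot.
Qed.

Lemma smul1g : left_id sone smul.
Proof.
apply: malg_ext; [exact: smul_linr | by [] |].
move=> c; rewrite -(class_reprK c) smulUU; last first.
  by rewrite disjoint_permsC.
rewrite (_ : shuffles _ _ = [:: class_repr c]) ?big_seq1 //.
apply: perm_small_eq => //; apply: uniq_perm; rewrite ?shuffles_uniq // => t.
rewrite mem_shufflesE /= inE sub0seq /=; apply/andP/eqP => [[tc ct]|->] //.
by apply/val_inj/esym/eqP; rewrite /= -(size_subseq_leqif ct) (perm_size tc).
Qed.

Lemma smulDl : left_distributive smul +%R.
Proof. by move=> g g' h; have := smul_linl h 1 g g'; rewrite !scale1r. Qed.

Lemma sone_neq0 : sone != 0.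
Proof. by rewrite monalgU_eq0 oner_eq0. Qed.

Lemma sscalerAl a g h : a *: smul g h = smul (a *: g) h.
Proof. by rewrite /smul linearZ. Qed.

End ShuffleProduct.

Definition shuffle_algebra (T : eqType) (st : statistic T)
  (sc : shuffle_compatible st) : Type := {malg rat[st_class st]}.

Section ShuffleAlgebra.
Variables (T : eqType) (st : statistic T) (sc : shuffle_compatible st).
Local Notation A := (shuffle_algebra sc).

HB.instance Definition _ := GRing.Lmodule.copy A {malg rat[st_class st]}.
HB.instance Definition _ := GRing.Zmodule_isComNzRing.Build A
  (smulA sc) (smulC sc) (smul1g sc) (@smulDl _ st) (@sone_neq0 _ st).
HB.instance Definition _ := GRing.Lmodule_isLalgebra.Build rat A (@sscalerAl _ st).
HB.instance Definition _ := GRing.Lalgebra_isComAlgebra.Build rat A.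

Definition perm_class (p : permutation) : A := << class_of st p >>.

Lemma perm_classM p q : disjoint_perms p q ->
  perm_class p * perm_class q = \sum_(t <- shuffles p q) perm_class t.
Proof. exact: smulUU. Qed.

Definition homogeneous_component (n : nat) : set A :=
  lin_span (perm_class @` [set p : permutation | size p = n])%classic.

End ShuffleAlgebra.

Arguments perm_class {T st} sc p.
Arguments homogeneous_component {T st} sc n.

Definition des (s : seq nat) : nat :=
  #|[pred i : 'I_(size s).-1 | (nth 0 s i.+1 < nth 0 s i)%N]|.

Definition monotone (s : seq nat) : bool := sorted ltn s || sorted gtn s.

(* The consecutive subsequence of s in positions i, ..., j - 1, for i < j. *)
Definition factor (s : seq nat) (i j : nat) := take (j - i) (drop i s).

Definition is_birun (s : seq nat) (i j : nat) : bool :=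
  [&& (i < j <= size s)%N, monotone (factor s i j) &
      [forall k : 'I_(size s).+1, forall l : 'I_(size s).+1,
         [&& (k <= i)%N, (j <= l)%N & monotone (factor s k l)] ==>
         ((k == i :> nat) && (l == j :> nat))]].

(* A one-letter birun only exists in length 1, where there is no descent, so
   an initial single letter is never counted twice. *)
Definition udr (s : seq nat) : nat :=
  (#|[pred r : 'I_(size s).+1 * 'I_(size s).+1 | is_birun s r.1 r.2]|
   + ((1 < size s) && (nth 0 s 1 < nth 0 s 0)))%N.

Lemma monotone_iso p q i j : order_iso p q -> (j <= size p)%N ->
  monotone (factor p i j) = monotone (factor q i j).
Proof.
move=> [pq iso] jp; have szf s : (j <= size s)%N -> size (factor s i j) = (j - i)%N.
  by move=> js; rewrite size_takel // size_drop leq_sub2r.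
have nthf s k : (k < j - i)%N -> nth 0%N (factor s i j) k = nth 0%N s (i + k).
  by move=> kj; rewrite nth_take // nth_drop.
have sz := szf _ jp; have szq : size (factor q i j) = (j - i)%N.
  by rewrite szf // -pq.
have lt_p k : (k.+1 < j - i)%N -> (i + k.+1 < size p)%N.
  by move=> kj; apply: leq_trans jp; rewrite -ltn_subRL.
have key (R : rel nat) :
    (forall a b, (a < size p)%N -> (b < size p)%N ->
       R (nth 0%N p a) (nth 0%N p b) = R (nth 0%N q a) (nth 0%N q b)) ->
    sorted R (factor p i j) = sorted R (factor q i j).
  move=> Rpq; apply/(sortedP 0%N)/(sortedP 0%N); rewrite sz szq => H k kj.
    have kp := lt_p _ kj; rewrite !nthf ?(ltnW kj) // -Rpq //.
      by have := H k kj; rewrite !nthf ?(ltnW kj).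
    by apply: leq_ltn_trans kp; rewrite leq_add2l.
  have kp := lt_p _ kj; rewrite !nthf ?(ltnW kj) // Rpq //.
    by have := H k kj; rewrite !nthf ?(ltnW kj).
  by apply: leq_ltn_trans kp; rewrite leq_add2l.
rewrite /monotone !key // => a b ap bp.
  by rewrite /= iso.
Qed.

Lemma is_birun_iso p q i j : order_iso p q -> is_birun p i j = is_birun q i j.
Proof.
move=> pq; rewrite /is_birun; have [sz _] := pq; rewrite -sz.
case: (boolP (i < j <= size p)%N) => //= /andP[_ jp].
rewrite (monotone_iso i pq jp); congr (_ && _).
apply: eq_forallb => k; apply: eq_forallb => l.
by rewrite (monotone_iso k pq) // -ltnS.
Qed.

Lemma udr_iso p q : order_iso p q -> udr p = udr q.
Proof.
move=> pq; have [sz iso] := pq; rewrite /udr -sz; congr (_ + _)%N.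
  by apply: eq_card => r; rewrite !inE (is_birun_iso _ _ pq).
by case: (ltnP 1 (size p)) => //= p1; rewrite iso // ltnW.
Qed.

Lemma des_iso p q : order_iso p q -> des p = des q.
Proof.
move=> [sz iso]; rewrite /des -sz; apply: eq_card => i; rewrite !inE.
have ip : (i.+1 < size p)%N by have := ltn_ord i; case: (size p) i => [[]|].
by rewrite iso // ltnW.
Qed.

Lemma udr_des_iso (p q : permutation) :
  order_iso p q -> (udr p, des p) = (udr q, des q).
Proof. by move=> pq; rewrite (udr_iso pq) (des_iso pq). Qed.

Definition udr_des : statistic (nat * nat)%type :=
  @Statistic _ (fun p : permutation => (udr p, des p)) udr_des_iso.

Record fps := Fps { fcoef : nat -> rat }.

HB.instance Definition _ := [isNew for fcoef].
HB.instance Definition _ := [Choice of fps by <:].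

Module FpsRing.
Implicit Types f g h : fps.

Lemma fpsP f g : fcoef f =1 fcoef g -> f = g.
Proof. by case: f g => [f] [g] /= /funext ->. Qed.

Definition zero := Fps (fun=> 0).
Definition opp f := Fps (fun n => - fcoef f n).
Definition add f g := Fps (fun n => fcoef f n + fcoef g n).
Definition one := Fps (fun n => (n == 0%N)%:R).
Definition mul f g :=
  Fps (fun n => \sum_(i < n.+1) fcoef f i * fcoef g (n - i)).

Lemma addA : associative add.
Proof. by move=> f g h; apply: fpsP => n /=; rewrite addrA. Qed.
Lemma addC : commutative add.
Proof. by move=> f g; apply: fpsP => n /=; rewrite addrC. Qed.
Lemma add0 : left_id zero add.
Proof. by move=> f; apply: fpsP => n /=; rewrite add0r. Qed.
Lemma addN : left_inverse zero opp add.
Proof. by move=> f; apply: fpsP => n /=; rewrite addNr. Qed.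

Definition trunc n f : {poly rat} := \poly_(i < n) fcoef f i.

Lemma mulE f g m n : (n < m)%N ->
  fcoef (mul f g) n = (trunc m f * trunc m g)`_n.
Proof.
move=> nm; rewrite coefM; apply: eq_bigr => i _; rewrite !coef_poly.
by rewrite (leq_ltn_trans (leq_subr _ _) nm) (leq_trans (ltn_ord i) nm).
Qed.

Lemma mulC : commutative mul.
Proof. by move=> f g; apply: fpsP => n; rewrite !(@mulE _ _ n.+1) // mulrC. Qed.

Lemma mulA : associative mul.
Proof.
suff assoc f g h n : fcoef (mul (mul f g) h) n =
    (trunc n.+1 f * trunc n.+1 g * trunc n.+1 h)`_n.
  move=> f g h; apply: fpsP => n; rewrite assoc mulC assoc.
  by congr _`_n; rewrite mulrC mulrA.
rewrite coefM; apply: eq_bigr => i _; rewrite (@mulE _ _ n.+1) //.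
by rewrite coef_poly (leq_ltn_trans (leq_subr _ _)).
Qed.

Lemma mul1 : left_id one mul.
Proof.
move=> f; apply: fpsP => n /=; rewrite big_ord_recl /= subn0 mul1r big1 ?addr0 //.
by move=> i _; rewrite mul0r.
Qed.

Lemma mulDl : left_distributive mul add.
Proof.
move=> f g h; apply: fpsP => n /=; rewrite -big_split; apply: eq_bigr => i _.
by rewrite mulrDl.
Qed.

Lemma one_neq0 : one != zero.
Proof. by apply/eqP=> /(congr1 (fcoef^~ 0%N))/eqP; rewrite oner_eq0. Qed.

End FpsRing.

HB.instance Definition _ := GRing.isZmodule.Build fps
  FpsRing.addA FpsRing.addC FpsRing.add0 FpsRing.addN.
HB.instance Definition _ := GRing.Zmodule_isComNzRing.Build fps
  FpsRing.mulA FpsRing.mulC FpsRing.mul1 FpsRing.mulDl FpsRing.one_neq0.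

Module FpsInverse.

Definition unit : {pred fps} := fun f => `[< exists g : fps, g * f = 1 >].
Definition inv (f : fps) : fps := xget f [set g : fps | g * f = 1].

Lemma mulVf : {in unit, left_inverse 1 inv *%R}.
Proof. by move=> f /asboolP[g gf]; rewrite /inv; case: xgetP => [h _ //|/(_ g)]. Qed.

Lemma unitPl (f g : fps) : g * f = 1 -> unit f.
Proof. by move=> gf; apply/asboolP; exists g. Qed.

Lemma inv_out : {in [predC unit], inv =1 id}.
Proof.
move=> f /negP nf; rewrite /inv; case: xgetP => [g _ gf|//].
by case: nf; exact: unitPl gf.
Qed.

End FpsInverse.

HB.instance Definition _ := GRing.ComNzRing_hasMulInverse.Build fps
  FpsInverse.mulVf FpsInverse.unitPl FpsInverse.inv_out.

Definition ft : fps := Fps (fun n => (n == 1%N)%:R).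

Lemma fcoef_tXM k f n :
  fcoef (ft ^+ k * f) n = if (n < k)%N then 0 else fcoef f (n - k).
Proof.
elim: k n => [|k IHk] n; first by rewrite mul1r subn0.
rewrite exprS -mulrA [LHS](_ : _ =
  \sum_(i < n.+1) fcoef ft i * fcoef (ft ^+ k * f) (n - i)) //.
case: n => [|n]; first by rewrite big_ord1 /= mul0r.
rewrite 2!big_ord_recl mul0r add0r mul1r [X in _ + X]big1 ?addr0 => [|i _].
  by rewrite lift0 subSS subn0 IHk subSS ltnS.
by rewrite mul0r.
Qed.

Lemma geometric_series k :
  (1 - ft ^+ k.+1) * Fps (fun n => (k.+1 %| n)%:R) = 1.
Proof.
apply: FpsRing.fpsP => n; rewrite mulrBl mul1r.
rewrite [LHS](_ : _ = (k.+1 %| n)%:R -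
  fcoef (ft ^+ k.+1 * Fps (fun n => (k.+1 %| n)%:R)) n) // fcoef_tXM.
case: ltnP => [nk|kn] /=.
  rewrite subr0; case: n nk => [|n] nk; first by rewrite dvdn0.
  by rewrite gtnNdvd.
by rewrite dvdn_subl // subrr; case: n kn.
Qed.

Lemma unit_1BtX k : 1 - ft ^+ k.+1 \is a GRing.unit.
Proof.
by apply: (FpsInverse.unitPl (g := Fps _)); rewrite mulrC; exact: geometric_series.
Qed.

(* The functions nat -> rat carry the pointwise ring structure: as sequences of
   coefficients of power series in t, this is the Hadamard product. The inner
   variable is y and the outer one is x. *)
Definition hadamard_xy : Type := {poly {poly (nat -> rat)}}.

HB.instance Definition _ := GRing.ComNzRing.copy hadamard_xy {poly {poly (nat -> rat)}}.

Definition hscale (c : rat) (p : hadamard_xy) : hadamard_xy :=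
  ((cst c : nat -> rat)%:P)%:P * p.

Lemma hscaleA a b p : hscale a (hscale b p) = hscale (a * b) p.
Proof. by rewrite /hscale mulrA -!polyCM. Qed.
Lemma hscale1 : left_id 1 hscale.
Proof. by move=> p; rewrite /hscale [X in X * _](_ : _ = 1) ?mul1r. Qed.
Lemma hscaleDr : right_distributive hscale +%R.
Proof. by move=> a p q; rewrite /hscale mulrDr. Qed.
Lemma hscaleDl p : {morph hscale^~ p : a b / a + b}.
Proof. by move=> a b; rewrite /hscale -mulrDl -!polyCD. Qed.

HB.instance Definition _ := GRing.Zmodule_isLmodule.Build rat hadamard_xy
  hscaleA hscale1 hscaleDr hscaleDl.

Lemma hscaleAl a (p q : hadamard_xy) : a *: (p * q) = (a *: p) * q.
Proof. exact: mulrA. Qed.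

HB.instance Definition _ := GRing.Lmodule_isLalgebra.Build rat hadamard_xy hscaleAl.
HB.instance Definition _ := GRing.Lalgebra_isComAlgebra.Build rat hadamard_xy.

(* The element of Q[[t*]][x, y] given by f x^n, for f in Q[[t]][y]. *)
Definition monomial_x (f : {poly fps}) (n : nat) : hadamard_xy :=
  (map_poly fcoef f)%:P * 'X^n.

(* 1 / ((1 - t) (1 - t^2)^n), for the ordinary product of power series. *)
Definition inv_denominator (n : nat) : fps := ((1 - ft) * (1 - ft ^+ 2) ^+ n)^-1.

Local Notation t := (polyC ft).
Local Notation y := (polyX fps).

(* uphalf u and u./2 are the ceiling and the floor of u / 2. All these truncated
   subtractions are exact for n = |p| >= 1, u = udr p and d = des p; writing
   1 - uphalf u + u./2 for the last exponent would be wrong. *)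
Definition numerator (n u d : nat) : {poly fps} :=
  t ^+ u * (1 + y) ^+ (u - 1) * (1 + y * t ^+ 2) ^+ (n - d - uphalf u)
  * (y + t ^+ 2) ^+ (d - u./2) * (1 + y * t) ^+ (uphalf u - u./2)
  * (y + t) ^+ (1 + u./2 - uphalf u).

Definition class_image (p : permutation) : hadamard_xy :=
  if size p == 0%N then monomial_x (inv_denominator 0)%:P 0
  else monomial_x (inv_denominator (size p) *: numerator (size p) (udr p) (des p))
         (size p).

Definition S_factor (j : nat) : {poly fps} := if odd j then 1 + y * t else y + t.

Definition generators : set hadamard_xy :=
  [set monomial_x (inv_denominator 0)%:P 0]
  `|` [set f | exists2 n, (1 <= n)%N &
         f = monomial_x
               (inv_denominator n *: (t * (1 + y * t) * (1 + y * t ^+ 2) ^+ (n - 1))) n]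
  `|` [set f | exists n j k,
         [/\ (1 <= n)%N, (2 <= j <= n)%N, (j./2 <= k <= n - uphalf j)%N &
         f = monomial_x
               (inv_denominator n *:
                  (t ^+ j * (1 + y) ^+ (j - 1)
                   * (1 + y * t ^+ 2) ^+ (n - k - uphalf j)
                   * (y + t ^+ 2) ^+ (k - j./2) * S_factor j)) n]].

(* Main.v *)
Require Import Defs.
From HB Require Import structures.
From mathcomp Require Import all_boot all_order all_algebra.
From mathcomp Require Import finmap generic_quotient monalg.
From mathcomp Require Import mathcomp_extra boolp classical_sets functions.
From mathcomp Require Import zify ring.

(* Colour the letters of pi weakly increasingly with colours 1, ..., m, where
   consecutive letters may share an odd colour only at an ascent and an even
   colour only at a descent, and weight a colouring by y^(number of even colours).
   The weighted number of colourings of pi is the coefficient of t^m in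
   N_pi / ((1-t)(1-t^2)^n): appending a letter multiplies the odd part (in t) of
   this series, after an ascent, or its even part, after a descent, by a fixed
   rational function. A function from letters to colours determines a unique
   word that it colours, so that the product over pi and sigma is the sum over
   their shuffles. Finally N_pi starts with t^u (1+y)^(u-1) y^(..), with distinct
   powers of y for distinct d, so that the images of distinct classes are
   linearly independent; this gives both the shuffle-compatibility and the
   injectivity. *)

Set Implicit Arguments.
Unset Strict Implicit.
Unset Printing Implicit Defensive.

Import GRing.Theory.

Local Open Scope nat_scope.

(** * Biruns and turning points *)

Definition desc (s : seq nat) i := nth 0 s i.+1 < nth 0 s i.

(** The value at 0 acts as an ascent before the first letter, so an initial descent makes 0 a turn;
    that turn accounts for the one-letter up-down run. *)
Definition prev_desc (s : seq nat) i := if i is k.+1 then desc s k else false.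

Definition turn (s : seq nat) i := prev_desc s i != desc s i.

(** Letters are distinct, so a non-descent is a strict ascent, and monotone means that [desc] is
    constant on the steps of the factor. Only its interior positions are constrained. *)
Lemma monotone_factorP (s : seq nat) i j : uniq s -> j <= size s ->
  reflect (forall c, i < c -> c.+1 < j -> ~~ turn s c) (monotone (factor s i j)).
Proof.
move=> us js.
have sz : size (factor s i j) = j - i.
  by rewrite size_takel // size_drop leq_sub2r.
have sortedE (R : rel nat) : sorted R (factor s i j) <->
    forall k, i <= k -> k.+1 < j -> R (nth 0 s k) (nth 0 s k.+1).
  have nthf k : k < j - i -> nth 0 (factor s i j) k = nth 0 s (i + k).
    by move=> kj; rewrite nth_take // nth_drop.
  split=> [/(sortedP 0)|] H; last apply/(sortedP 0); rewrite ?sz in H * => k.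
    move=> ik kj; have := H (k - i).
    rewrite !nthf; [|lia|lia].
    by rewrite addnS subnKC //; apply; lia.
  move=> kj; rewrite !nthf; [|lia|lia].
  by rewrite addnS; apply: H; lia.
have ltnE k : k.+1 < j -> (nth 0 s k < nth 0 s k.+1) = ~~ desc s k.
  move=> kj; have ks : k.+1 < size s by lia.
  rewrite /desc -leqNgt ltn_neqAle nth_uniq ?(ltnW ks) //.
  by rewrite neq_ltn ltnSn.
apply: (iffP orP) => [[] /sortedE H [//|c] ic cj|H].
- have /= h0 := H c ic (ltnW cj); have /= h1 := H c.+1 (leqW ic) cj.
  have := ltnE c (ltnW cj); have := ltnE c.+1 cj; rewrite /turn /= h0 h1.
  by move=> /esym/negPf-> /esym/negPf->.
- have /= := H c ic (ltnW cj); have /= := H c.+1 (leqW ic) cj.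
  by rewrite /turn /= /desc => -> ->.
have const k : i <= k -> k.+1 < j -> desc s k = desc s i.
  elim: k => [|k IHk] ik kj; first by have -> : i = 0 by lia.
  have [ik'|ik'] := ltnP i k.+1; last by have -> : i = k.+1 by lia.
  by have := H k.+1 ik' kj; rewrite /turn negbK => /eqP /= <-; apply: IHk; lia.
case: (boolP (desc s i)) => di; [right|left]; apply/sortedE => k ik kj.
  by have := const k ik kj; rewrite di.
by rewrite /= ltnE // const.
Qed.

(** Consecutive biruns share their turning letter. The last letter ends a birun and starts one only
    when it is also the first. *)
Definition birun_start (s : seq nat) i :=
  (i == 0) || ((i.+1 < size s) && turn s i).

Lemma birun_startP (s : seq nat) i : uniq s -> i < size s ->
  reflect (exists j, is_birun s i j) (birun_start s i).
Proof.
move=> us si; apply: (iffP idP) => [st|[j /and3P[/andP[ij js] mij /forallP max]]].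
  (* The birun is the longest monotone factor starting at [i]; the turn at [i] prevents an extension
     to the left. *)
  pose P j := (i < j <= size s) && monotone (factor s i j).
  have Pex : exists j, P j.
    exists i.+1; rewrite /P ltnSn si /=; apply/monotone_factorP => // c; lia.
  have Pub j : P j -> j <= size s by case/andP=> /andP[].
  case: (ex_maxnP Pex Pub) => j /andP[ijs mij] jmax.
  have [ij js] := andP ijs.
  exists j; apply/and3P; split=> //; apply/forallP=> k; apply/forallP=> l.
  apply/implyP=> /and3P[ki jl mkl].
  have ls : l <= size s by rewrite -ltnS.
  have [ik|ik] := ltnP k i; last first.
    have ek : k = i :> nat by apply/eqP; rewrite eqn_leq ki.
    rewrite ek eqxx eqn_leq jl andbT /=; apply: jmax.
    by rewrite /P -ek mkl ls /= ek (leq_trans ij jl) .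
  have i0 : (i == 0) = false by lia.
  move: st; rewrite /birun_start i0 /= => /andP[si2 ti].
  have: i.+2 <= j.
    apply: jmax; rewrite /P si2 leqW //=.
    by apply/monotone_factorP => // c; lia.
  by move=> ij2; case/negP: (monotone_factorP k us ls mkl i ik (leq_trans ij2 jl)).
rewrite /birun_start; case: i => [//|i] in si ij mij max *; rewrite /=.
(* Without a turn the factor could be extended by one letter to the left, against maximality. *)
apply/negPn/negP=> nst.
have k_lt : i < (size s).+1 by lia.
have l_lt : j < (size s).+1 by lia.
have /forallP/(_ (Ordinal l_lt))/implyP/= := max (Ordinal k_lt).
move=> H; suff /H /andP[/eqP] : [&& i <= i.+1, j <= j & monotone (factor s i j)] by lia.
apply/and3P; split=> //; apply/monotone_factorP => // c ic cj.
have [ei|ni] := eqVneq c i.+1; last by apply: (monotone_factorP i.+1 us js mij); lia.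
by move: nst; rewrite ei negb_and => /orP[|//]; lia.
Qed.

Lemma is_birun_inj (s : seq nat) i j l : is_birun s i j -> is_birun s i l -> j = l.
Proof.
move=> /and3P[/andP[ij js] mij /forallP maxj] /and3P[/andP[il ls] mil /forallP maxl].
have i_lt : i < (size s).+1 by lia.
have j_lt : j < (size s).+1 by lia.
have l_lt : l < (size s).+1 by lia.
have /forallP/(_ (Ordinal l_lt))/implyP/= := maxj (Ordinal i_lt).
have /forallP/(_ (Ordinal j_lt))/implyP/= := maxl (Ordinal i_lt).
rewrite leqnn mij mil eqxx /= !andbT.
by case: (leqP j l) => [_ _ /(_ isT)|lj /(_ (ltnW lj))] /eqP->.
Qed.

(** A birun is determined by its start, so counting starts suffices. *)
Lemma card_biruns (s : seq nat) : uniq s ->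
  #|[pred r : 'I_(size s).+1 * 'I_(size s).+1 | is_birun s r.1 r.2]| =
  \sum_(i < size s) birun_start s i.
Proof.
move=> us; rewrite -cardsE -(@card_in_imset _ _ fst); last first.
  move=> [i j] [k l]; rewrite !inE /= => b1 b2 ik; rewrite -ik in b2 *.
  by congr pair; apply: val_inj; apply: is_birun_inj b1 b2.
have iub (i : 'I_(size s).+1) j : is_birun s i j -> (i < size s) && (j <= size s).
  by case/and3P=> /andP[ij js] _ _; rewrite js (leq_trans ij js).
rewrite -sum1_card big_mkcond big_ord_recr /=.
rewrite ifF ?addn0; last first.
  apply/imsetP=> [[[i j]]]; rewrite inE /= => /iub /andP[si _] /(congr1 val) /= ei.
  by rewrite -ei ltnn in si.
apply: eq_bigr => i _; set x := widen_ord _ _.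
have -> : birun_start s i = (x \in [set x0.1 | x0 in
   [set x0 : 'I_(size s).+1 * 'I_(size s).+1 | is_birun s x0.1 x0.2]]).
  apply/birun_startP/imsetP => // [[j b]|[[k l]]].
    have /andP[_ js] := iub x j b; have j_lt : j < (size s).+1 by [].
    by exists (x, Ordinal j_lt); rewrite ?inE.
  by rewrite inE /= => b xk; exists l; rewrite -xk in b.
by case: (_ \in _).
Qed.

(** The turns at positive positions count the biruns after the first, and the turn at 0 counts the
    initial single letter. *)
Lemma udrE (s : seq nat) : uniq s ->
  udr s = (0 < size s) + \sum_(c < (size s).-1) turn s c.
Proof.
move=> us; rewrite /udr card_biruns //.
case E : (size s) => [|[|n]] /=; first by rewrite !big_ord0.
  by rewrite big_ord_recl !big_ord0.
rewrite big_ord_recl big_ord_recr /= [in RHS]big_ord_recl /birun_start /= E ltnn.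
rewrite /= addn0 -addnA; congr addn; rewrite addnC; congr addn.
  by rewrite /turn /= /desc; case: ltnP.
by apply: eq_bigr => i _; rewrite !ltnS ltn_ord.
Qed.

Lemma desE (s : seq nat) : des s = \sum_(c < (size s).-1) desc s c.
Proof.
rewrite /des -sum1_card big_mkcond; apply: eq_bigr => i _.
by rewrite inE -/(desc s i); case: desc.
Qed.

(** Each turn reverses the direction, so the parity of the number of turns reveals the latest
    step. *)
Lemma odd_sum_turn s k : odd (\sum_(c < k) turn s c) = prev_desc s k.
Proof.
elim: k => [|k IHk]; first by rewrite big_ord0.
by rewrite big_ord_recr /= oddD IHk oddb /turn; case: prev_desc desc => [] [].
Qed.

(** * Appending a letter *)

Section LastLetter.
Variables (s : seq nat) (b a : nat).
Hypothesis us : uniq (rcons (rcons s b) a).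

Let s1 := rcons s b.

Let desc_last : desc (rcons s1 a) (size s) = (a < b).
Proof.
by rewrite /desc !nth_rcons !size_rcons !ltnn !eqxx ltnSn.
Qed.

Let desc_prefix c : c < size s -> desc (rcons s1 a) c = desc s1 c.
Proof.
move=> cs; rewrite /desc [nth _ (rcons s1 a) c.+1]nth_rcons.
by rewrite [nth _ (rcons s1 a) c]nth_rcons size_rcons !ltnS cs (ltnW cs).
Qed.

Lemma des_rcons2 : des (rcons s1 a) = des s1 + (a < b).
Proof.
rewrite !desE !size_rcons /= big_ord_recr /= desc_last; congr addn.
by apply: eq_bigr => i _; rewrite desc_prefix.
Qed.

(* The last step of [s1] is a descent iff [udr s1] is even. *)
Lemma udr_rcons2 : udr (rcons s1 a) = udr s1 + (odd (udr s1) == (a < b)).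
Proof.
have us1 : uniq s1 by move: us; rewrite rcons_uniq => /andP[].
rewrite !udrE // !size_rcons /= big_ord_recr /= -addnA; congr addn.
have eq_turn c : c < size s -> turn (rcons s1 a) c = turn s1 c.
  by case: c => [|c] cs; rewrite /turn /= ?desc_prefix // ltnW.
rewrite (eq_bigr (fun c : 'I_(size s) => turn s1 c : nat)); last first.
  by move=> c _; rewrite eq_turn.
congr addn; rewrite oddD odd_sum_turn /turn desc_last.
have -> : prev_desc (rcons s1 a) (size s) = prev_desc s1 (size s).
  by case E : (size s) => [|c] //=; rewrite desc_prefix ?E.
by case: prev_desc (a < b) => [] [].
Qed.

End LastLetter.

(** * The pairs of values that occur *)

Lemma udr1 a : udr [:: a] = 1.
Proof. by rewrite udrE //= big_ord0. Qed.

Lemma des1 a : des [:: a] = 0.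
Proof. by rewrite desE big_ord0. Qed.

Lemma udr0 : udr [::] = 0.
Proof. by rewrite udrE //= big_ord0. Qed.

Lemma des0 : des [::] = 0.
Proof. by rewrite desE big_ord0. Qed.

(* The pairs of values of (udr, des) on permutations of length [n]. *)
Definition admissible (n : nat) (x : nat * nat) :=
  if n == 0 then x == (0, 0)
  else (x == (1, 0)) || [&& 2 <= x.1, (x.1)./2 <= x.2 & x.2 + uphalf x.1 <= n].

Lemma admissible_udr_des (s : seq nat) :
  uniq s -> admissible (size s) (udr s, des s).
Proof.
elim/last_ind: s => [|s a IHs] us; first by rewrite udr0 des0.
case/lastP: s => [|s b] in us IHs *; first by rewrite udr1 des1.
have /IHs {IHs} : uniq (rcons s b) by move: us; rewrite rcons_uniq => /andP[].
rewrite udr_rcons2 // des_rcons2 !size_rcons /admissible /= !xpair_eqE /=.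
by lia.
Qed.

Lemma perm_append (p : permutation) (e : bool) : 0 < size p ->
  exists2 q : permutation, size q = (size p).+1 &
    udr q = udr p + (odd (udr p) == e) /\ des q = des p + e.
Proof.
case: p => [s /= sP]; case/lastP: s sP => [//|s b] sP _.
case: e.
  have P : uniq (rcons (map (addn 1) (rcons s b)) 1)
         && all (ltn 0) (rcons (map (addn 1) (rcons s b)) 1).
    case/andP: sP => us ps.
    rewrite rcons_uniq all_rcons /= (map_inj_uniq (@addnI 1)) us andbT.
    apply/andP; split; first by apply/mapP=> [[x xs]]; have /= := allP ps x xs; lia.
    by apply/allP=> _ /mapP[x xs ->].
  exists (Permutation P); first by rewrite /= size_rcons size_map.
  have iso := raise_iso 1 (Permutation sP).
  rewrite -(udr_iso iso) -(des_iso iso) /=.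
  have [+ _] := andP P; rewrite map_rcons => uP.
  rewrite udr_rcons2 // des_rcons2 //.
  have -> // : 1 < 1 + b by case/andP: (sP) => _; rewrite all_rcons /=; lia.
set m := max_letter (Permutation sP).
have P : uniq (rcons (rcons s b) m.+1) && all (ltn 0) (rcons (rcons s b) m.+1).
  rewrite rcons_uniq all_rcons /=; case/andP: (sP) => -> ->; rewrite !andbT.
  by apply/negP=> /(max_letterP (p := Permutation sP)); rewrite -/m ltnn.
exists (Permutation P); first by rewrite /= size_rcons.
have [uP _] := andP P.
rewrite /= udr_rcons2 // des_rcons2 //.
have -> // : (m.+1 < b) = false.
have : b <= m.
  by apply: (max_letterP (p := Permutation sP)); rewrite /= mem_rcons mem_head.
lia.
Qed.

Lemma admissible_realized (n : nat) (x : nat * nat) : admissible n x ->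
  exists2 p : permutation, size p = n & (udr p, des p) = x.
Proof.
elim: n x => [|n IHn] [u d].
  move/eqP=> ->.
  by exists empty_perm; rewrite //= udr0 des0.
have [->|n0] := eqVneq n 0.
  have P : uniq [:: 1] && all (ltn 0) [:: 1] by [].
  move=> adm; exists (Permutation P); rewrite //= udr1 des1.
  by move: adm; rewrite /admissible /= !xpair_eqE => adm; congr pair; lia.
have step (u' d' : nat) (e : bool) : admissible n (u', d') ->
    u = u' + (odd u' == e) -> d = d' + e ->
    exists2 p : permutation, size p = n.+1 & (udr p, des p) = (u, d).
  move=> /IHn[p pn [pu pd]] -> ->.
  have [|q qn [qu qd]] := @perm_append p e; first by rewrite pn lt0n.
  by exists q; rewrite ?qn ?pn // qu qd pu pd.
rewrite /admissible /= !xpair_eqE /= => adm.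
(* The last step must be a descent exactly when [u] is even. Deleting the last letter lowers [d] by
   [e] and either keeps [u] or lowers it by one. *)
pose e := ~~ odd u.
case: (boolP (admissible n (u, d - e))) => adm'.
  have [ed|ed] := leqP e d; first by apply: (step u (d - e) e) => //; lia.
  by move: adm' adm; rewrite /admissible (negPf n0) /= !xpair_eqE /=; lia.
by apply: (step (u - 1) (d - e) e);
  rewrite /admissible ?(negPf n0) ?xpair_eqE /= in adm' *; lia.
Qed.

(** * Colourings *)

(* Orders coloured letters (letter, colour) by colour, breaking ties by
   increasing letters for odd colours and by decreasing letters for even ones. *)
Definition cle (x y : nat * nat) :=
  (x.2 < y.2) || ((x.2 == y.2) && (if odd x.2 then x.1 <= y.1 else y.1 <= x.1)).

Lemma cle_trans : transitive cle.
Proof.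
move=> [y c] [x b] [z d]; rewrite /cle /=.
case/orP=> [bc|/andP[/eqP-> xy]] /orP[cd|/andP[/eqP<- yz]].
- by rewrite (ltn_trans bc cd).
- by rewrite bc.
- by rewrite cd.
by rewrite eqxx ltnn /=; case: ifP xy yz; lia.
Qed.

Lemma cle_total : total cle.
Proof.
move=> [x b] [y c]; rewrite /cle /=.
by case: (ltngtP b c) => //= ->; case: odd; lia.
Qed.

Lemma cle_anti : antisymmetric cle.
Proof.
move=> [x b] [y c]; rewrite /cle /= => H; have e : b = c by lia.
by move: H; rewrite e eqxx ltnn /=; case: odd => H; congr pair; lia.
Qed.

(** A colouring is kept as a list of pairs (letter, colour), so that for distinct letters the
    condition on colours becomes sortedness for [cle]. *)
Fixpoint colourings (m : nat) (s : seq nat) : seq (seq (nat * nat)) :=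
  if s is a :: s' then
    [seq z <- [seq (a, c) :: z | c <- iota 1 m, z <- colourings m s']
       | sorted cle z]
  else [:: [::]].

Lemma mem_colourings m s z : (z \in colourings m s) =
  [&& unzip1 z == s, all (fun x => 0 < x.2 <= m) z & sorted cle z].
Proof.
elim: s z => [|a s IHs] [|[b c] z] //=.
  by rewrite mem_filter; apply/andP=> [[_ /allpairsP[[? ?] []]]].
rewrite mem_filter; apply/idP/idP => [/andP[/= -> /allpairsP[[d w] /= [dm wm]]]|].
  case=> -> -> ->; move: wm; rewrite IHs => /and3P[/eqP-> -> _].
  by move: dm; rewrite mem_iota add1n ltnS eqxx !andbT.
case/and3P=> /eqP[-> zs] /andP[cm zm] srt; rewrite /= srt.
apply/allpairsP; exists (c, z); split=> //=; first by rewrite mem_iota add1n ltnS.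
by rewrite IHs zs zm eqxx (path_sorted srt).
Qed.

Lemma colourings_uniq m s : uniq (colourings m s).
Proof.
elim: s => [|a s IHs] //=; rewrite filter_uniq //.
by apply: allpairs_uniq; rewrite ?iota_uniq // => -[c z] [d w] _ _ [-> ->].
Qed.

Local Open Scope ring_scope.

(** ['X] stands for the variable y. *)
Definition wt (c : nat) : {poly rat} := if odd c then 1 else 'X.

Definition weight (z : seq (nat * nat)) := \prod_(x <- z) wt x.2.

Definition colour_gf (s : seq nat) (m : nat) : {poly rat} :=
  \sum_(z <- colourings m s) weight z.

(* A pair of coloured permutations is sorted into a single coloured shuffle. *)
Lemma colour_gf_shuffle p q m : disjoint_perms p q ->
  colour_gf p m * colour_gf q m = \sum_(r <- shuffles p q) colour_gf r m.
Proof.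
move=> pq; pose mg z1 z2 := sort cle (z1 ++ z2).
(* Merging is undone by filtering on letters: filtering commutes with sorting, and [z1] is already
   sorted. *)
have fmg (a : pred nat) (z1 z2 : seq (nat * nat)) : (forall x, x \in unzip1 z1 -> a x) ->
    (forall x, x \in unzip1 z2 -> ~~ a x) -> sorted cle z1 ->
    filter (preim fst a) (mg z1 z2) = z1.
  move=> h1 h2 s1; rewrite /mg (filter_sort cle_total cle_trans) filter_cat.
  have -> : filter (preim fst a) z1 = z1.
    by apply/all_filterP/allP=> x xz; apply: h1; apply: map_f.
  have -> : filter (preim fst a) z2 = [::].
    apply/eqP; rewrite -(negbK (_ == _)) -has_filter; apply/hasPn=> x xz /=.
    by apply: h2; apply: map_f.
  by rewrite cats0 sorted_sort //; apply: cle_trans.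
have mgC z1 z2 : mg z1 z2 = mg z2 z1.
  apply/perm_sortP; [exact: cle_total|exact: cle_trans|exact: cle_anti|].
  by rewrite perm_catC.
have npq x : x \in letters q -> x \notin letters p by apply: (hasPn pq).
have nqp x : x \in letters p -> x \notin letters q.
  by apply: contraL => /npq.
pose L := [seq mg z1 z2 | z1 <- colourings m p, z2 <- colourings m q].
have LP z1 z2 : z1 \in colourings m p -> z2 \in colourings m q ->
    filter (preim fst [in letters p]) (mg z1 z2) = z1 /\
    filter (preim fst [in letters q]) (mg z1 z2) = z2.
  rewrite !mem_colourings => /and3P[/eqP e1 _ s1] /and3P[/eqP e2 _ s2].
  by split; [|rewrite mgC]; apply: fmg; rewrite // ?e1 ?e2.
have -> : colour_gf p m * colour_gf q m = \sum_(z <- L) weight z.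
  rewrite /L big_allpairs_dep /colour_gf mulr_suml; apply: eq_bigr => z1 _.
  rewrite mulr_sumr; apply: eq_bigr => z2 _.
  rewrite /weight -big_cat; apply: perm_big.
  by rewrite perm_sym perm_sort.
pose L' := [seq z | r <- shuffles p q, z <- colourings m (letters r)].
have -> : \sum_(r <- shuffles p q) colour_gf r m = \sum_(z <- L') weight z.
  by rewrite /L' big_allpairs_dep.
(* Both lists are duplicate-free, so it remains to match their members: a merge of two colourings
   colours exactly one shuffle, and a coloured shuffle splits into its restrictions to [p] and
   [q]. *)
apply: perm_big; apply: uniq_perm => [||z].
- apply: allpairs_uniq; rewrite ?colourings_uniq //.
  move=> [z1 z2] [w1 w2] /allpairsP[[? ?] /= [h1 h2 [-> ->]]].
  move=> /allpairsP[[? ?] /= [h3 h4 [-> ->]]] e.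
  have [f1 f2] := LP _ _ h1 h2; have [f3 f4] := LP _ _ h3 h4.
  by congr pair; [rewrite -f1 e | rewrite -f2 e].
- apply: allpairs_uniq_dep; rewrite ?shuffles_uniq //.
    by move=> r _; apply: colourings_uniq.
  move=> _ _ /allpairsPdep[r [z [_ + ->]]] /allpairsPdep[r' [z' [_ + ->]]] /= zz.
  rewrite -zz !mem_colourings => /andP[/eqP e _] /andP[/eqP e' _].
  by have -> : r = r' by apply: val_inj; rewrite /= -e -e'.
apply/allpairsP/allpairsPdep => [[[z1 z2] /= [h1 h2 ->]]|[r [w [rpq + ->]]]].
  have [f1 f2] := LP _ _ h1 h2.
  move: h1 h2; rewrite !mem_colourings => /and3P[/eqP e1 a1 s1] /and3P[/eqP e2 a2 s2].
  have prm : perm_eq (unzip1 (mg z1 z2)) (p ++ q).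
    by rewrite -e1 -e2 -map_cat; apply: perm_map; rewrite perm_sort.
  have P : uniq (unzip1 (mg z1 z2)) && all (ltn 0) (unzip1 (mg z1 z2)).
    rewrite (perm_uniq prm) (perm_all _ prm) uniq_cat_perms //= all_cat.
    by rewrite !letters_gt0.
  exists (Permutation P), (mg z1 z2); split=> //.
    have sub a : subseq (unzip1 (filter a (mg z1 z2))) (unzip1 (mg z1 z2)).
      exact/map_subseq/filter_subseq.
    have := sub (preim fst [in letters p]); have := sub (preim fst [in letters q]).
    by rewrite f1 f2 e1 e2 mem_shufflesE /= prm => -> ->.
  rewrite mem_colourings eqxx sort_sorted ?andbT; last exact: cle_total.
  by rewrite all_sort all_cat a1 a2.
rewrite mem_colourings => /and3P[/eqP er az sz].
move: rpq; rewrite mem_shufflesE => /and3P[prm pr qr].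
exists (filter (preim fst [in letters p]) w, filter (preim fst [in letters q]) w).
have key (s : seq nat) : uniq s -> subseq s r ->
    filter (preim fst [in s]) w \in colourings m s.
  move=> us sr; rewrite mem_colourings sorted_filter ?andbT //; last exact: cle_trans.
  rewrite /unzip1 -filter_map -/(unzip1 w) er.
  rewrite -(subseq_uniqP (perm_uniq_letters r) sr) eqxx /=.
  by rewrite all_filter; apply: sub_all az => x xm; apply/implyP.
split; [exact: key (perm_uniq_letters p) pr | exact: key (perm_uniq_letters q) qr |].
(* Two sorted lists for an antisymmetric order agree as soon as they are rearrangements of each
   other. *)
apply: (sorted_eq cle_trans cle_anti) => //; first exact/sort_sorted/cle_total.
pose in_p := preim (@fst nat nat) [in letters p].
rewrite perm_sym perm_sort -(permPr (permEl (perm_filterC in_p w))) perm_cat2l.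
have -> // : filter (preim fst [in letters q]) w = filter (predC in_p) w.
apply: eq_in_filter => x xz /=; apply/idP/idP => [/npq //|].
have : x.1 \in p ++ q by rewrite -(perm_mem prm) -er map_f.
by rewrite mem_cat => /orP[->|].
Qed.

Lemma colour_gf_nil m : colour_gf [::] m = 1.
Proof. by rewrite /colour_gf big_seq1 /weight big_nil. Qed.

Lemma colour_gf0 s : (0 < size s)%N -> colour_gf s 0 = 0.
Proof. by case: s => //= a s _; rewrite /colour_gf big_nil. Qed.

(** * Recursion in the number of colours *)

Lemma sorted_colour z x y : sorted cle (rcons z x) -> y \in z -> (y.2 <= x.2)%N.
Proof.
move=> srt yz; suff /orP[/ltnW//|/andP[/eqP-> //]] : cle y x.
move: srt; rewrite -cats1 (sorted_pairwise cle_trans) pairwise_cat.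
by case/and3P=> /allrelP/(_ y x yz (mem_head _ _)).
Qed.

Lemma sorted_rcons_cle (z : seq (nat * nat)) x :
  sorted cle (rcons z x) = (z == [::]) || sorted cle z && cle (last x z) x.
Proof. by case: z => [|y z] //=; rewrite rcons_path. Qed.

(* The colouring of the last letter [a] either avoids the colour [m.+1] or uses it. *)
Lemma colour_gf_rcons s a m (e : bool) : uniq (rcons s a) ->
    (forall b s', s = rcons s' b -> e = if odd m.+1 then (b < a)%N else (a < b)%N) ->
  colour_gf (rcons s a) m.+1 = colour_gf (rcons s a) m + wt m.+1 * colour_gf s (m + e).
Proof.
move=> us eP.
rewrite /colour_gf.
(* The colourings in which [a] has colour [m.+1]. The flag [e] says whether the letter before [a]
   may share this colour, hence [m + e] colours for [s]. *)
pose L := [seq rcons z (a, m.+1) | z <- colourings (m + e) s].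
have -> : wt m.+1 * (\sum_(z <- colourings (m + e) s) weight z) =
          \sum_(z <- L) weight z.
  rewrite big_map mulr_sumr; apply: eq_bigr => z _.
  by rewrite /weight -cats1 big_cat big_seq1 mulrC.
rewrite -big_cat; apply: perm_big; apply: uniq_perm; first exact: colourings_uniq.
  rewrite cat_uniq colourings_uniq map_inj_uniq ?colourings_uniq ?andbT /=; last first.
    by move=> z w /rcons_inj[].
  apply/hasPn=> _ /mapP[z _ ->]; rewrite mem_colourings all_rcons /= ltnn.
  by rewrite andbF.
move=> z; rewrite mem_cat mem_colourings.
case/lastP: z => [|z [b c]].
  have -> : ([::] \in L) = false by apply/negP=> /mapP[[|? ?]].
  by rewrite mem_colourings orbF.
rewrite mem_colourings /unzip1 map_rcons all_rcons /=.
have memL : (rcons z (b, c) \in L) =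
    [&& z \in colourings (m + e) s, b == a & c == m.+1].
  apply/mapP/and3P => [[w wL] /rcons_inj [-> -> ->]|[zL /eqP-> /eqP->]]; first by [].
  by exists z.
rewrite memL mem_colourings /unzip1 eqseq_rcons.
case: (altP (map fst z =P s)) => //= zs; case: eqP => //= ba; rewrite ?andbF //.
case: (boolP (sorted cle (rcons z (b, c)))) => srt; last first.
  rewrite !andbF /=; apply/esym/negP=> /andP[/andP[az sz] /eqP cm].
  case/negP: srt; rewrite sorted_rcons_cle sz /=.
  case/lastP: z => [|z [b' c']] in zs az sz memL *; first by [].
  rewrite last_rcons; apply/orP; right.
  have /= := eP b' (map fst z); rewrite -zs /unzip1 map_rcons => /(_ erefl) ee.
  move: az; rewrite all_rcons => /andP[/= + _]; rewrite /cle /= cm ba.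
  have [->|] := eqVneq c' m.+1; last first.
    by move=> ne h; apply/orP; left; case: e {eP ee memL L} h => h; lia.
  rewrite ltnn /=; move: ee => /= ->.
  case: odd => /=; [case: (ltnP a b') | case: (ltnP b' a)] => h;
    rewrite ?addn0 ?ltnn ?andbF // => _; exact: ltnW.
have le_c x : x \in z -> (x.2 <= c)%N by apply: (sorted_colour srt).
have sz : sorted cle z.
  by move: srt; rewrite sorted_rcons_cle; case: z {zs memL le_c} => //= x z /andP[].
rewrite !andbT sz andbT.
(* A colour of [a] below [m.+1] gives the first list, [m.+1] gives [L], and a larger one gives
   neither. *)
have [cm|cm|cm] := ltngtP c m.+1; rewrite ?andbF ?orbF /=.
- rewrite all_rcons /= -[(c <= m)%N]ltnS cm; congr andb.
  apply: eq_in_all => x xz /=.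
  by rewrite !(leq_trans (le_c x xz)) ?(ltnW cm).
- by rewrite all_rcons /= (_ : (c <= m)%N = false) ?andbF //; lia.
rewrite all_rcons /= cm ltnn /= andbT.
apply: eq_in_all => x xz /=.
case: (boolP e) => ee; first by rewrite addn1.
rewrite addn0; suff xm : (x.2 <= m)%N by rewrite xm leqW.
(* When [e] is false, a colour [m.+1] inside [z] forces its last letter to have it too, and the tie
   rule with [a] then fails. *)
rewrite leqNgt; apply/negP=> xm.
case/lastP: z => [|z [b' c']] in zs sz memL le_c srt xz *; first by [].
have /= := eP b' (map fst z); rewrite -zs /unzip1 map_rcons => /(_ erefl) e0.
have c'm : c' = m.+1.
  have : (x.2 <= c')%N.
    move: xz; rewrite mem_rcons inE => /orP[/eqP->//|xz].
    exact: (sorted_colour sz xz).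
  have /= : ((b', c').2 <= c)%N by apply: le_c; rewrite mem_rcons mem_head.
  by rewrite cm => h1 h2; apply/eqP; rewrite eqn_leq h1 (leq_trans xm h2).
move: srt; rewrite sorted_rcons_cle last_rcons; case/orP.
  by case: z {zs memL sz le_c xz}.
case/andP=> _; rewrite /cle /= c'm cm ltnn eqxx /=.
have : b' != a.
  apply/eqP=> b'a; move: us; rewrite -zs map_rcons rcons_uniq mem_rcons /= b'a.
  by rewrite mem_head.
by move: e0 ee; case: odd => -> /=; rewrite ba; lia.
Qed.

(** * Generating functions *)

Definition fcoef_at (m : nat) (f : fps) : rat := fcoef f m.

Lemma fcoef_at_is_zmod_morphism m : zmod_morphism (fcoef_at m).
Proof. by []. Qed.

HB.instance Definition _ m :=
  GRing.isZmodMorphism.Build fps rat (fcoef_at m) (fcoef_at_is_zmod_morphism m).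

Lemma fcoef_at0_is_monoid_morphism : monoid_morphism (fcoef_at 0).
Proof.
split=> // f g; rewrite [LHS](_ : _ =
  \sum_(i < 1) fcoef f i * fcoef g (0 - i)%N) //.
by rewrite big_ord1.
Qed.

HB.instance Definition _ :=
  GRing.isMonoidMorphism.Build fps rat (fcoef_at 0) fcoef_at0_is_monoid_morphism.

(* The coefficient of [t^m]. *)
Definition coeft (m : nat) : {poly fps} -> {poly rat} := map_poly (fcoef_at m).

HB.instance Definition _ m := GRing.Additive.on (coeft m).

HB.instance Definition _ := GRing.RMorphism.on (coeft 0).

Lemma coef_coeft m f k : (coeft m f)`_k = fcoef f`_k m.
Proof. exact: coef_map. Qed.

Local Notation t := (polyC ft).
Local Notation y := (polyX fps).

Lemma coeft_tXM k m f :
  coeft m (t ^+ k * f) = if (m < k)%N then 0 else coeft (m - k) f.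
Proof.
apply/polyP=> i; rewrite coef_coeft -polyC_exp coefCM fcoef_tXM.
by case: ifP; rewrite ?coef0 // coef_coeft.
Qed.

Lemma coeft0_tM f : coeft 0 (t * f) = 0.
Proof. by have := coeft_tXM 1 0 f; rewrite expr1. Qed.

Lemma coeftS_tM m f : coeft m.+1 (t * f) = coeft m f.
Proof. by have := coeft_tXM 1 m.+1 f; rewrite expr1 subSS subn0. Qed.

Lemma coeft_yM m f : coeft m (y * f) = 'X * coeft m f.
Proof.
apply/polyP=> -[|i]; rewrite !(coef_coeft, coefXM) //.
Qed.

(** * Parts of odd and even degree in t *)

Definition inv1t2 : {poly fps} := ((1 - ft ^+ 2)^-1)%:P.

Lemma inv1t2K : (1 - t ^+ 2) * inv1t2 = 1.
Proof.
by rewrite -polyC_exp -polyCN -polyCD -polyCM mulrV // unit_1BtX.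
Qed.

(** The two parts of the series with coefficients [colour_gf s m]. They are separated because both
    the weight and the tie rule of a colour depend on its parity. *)
Definition odd_even_parts (s : seq nat) (go ge : {poly fps}) :=
  forall m, coeft m go = (if odd m then colour_gf s m else 0) /\
            coeft m ge = (if odd m then 0 else colour_gf s m).

(** After an ascent only an odd new colour can be shared, so [go] enters unshifted at odd degrees
    and shifted by t at even ones. The empty [s] is included, which covers the first letter. *)
Lemma odd_even_parts_asc s a go ge go' ge' : uniq (rcons s a) ->
  (forall b s', s = rcons s' b -> (b < a)%N) ->
  odd_even_parts s go ge ->
  go' = t * ge' + go -> ge' = t * go' + y * (t * go) ->
  odd_even_parts (rcons s a) go' ge'.
Proof.
move=> us asc oe ego ege m.
have G0 : colour_gf (rcons s a) 0 = 0 by rewrite colour_gf0 // size_rcons.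
elim: m => [|m [IHo IHe]].
  split; [rewrite {1}ego|rewrite {1}ege]; rewrite raddfD /= ?coeft_yM !coeft0_tM /= ?G0.
    by rewrite (oe 0%N).1 addr0.
  by rewrite mulr0 addr0.
have -> : coeft m.+1 go' = coeft m ge' + coeft m.+1 go.
  by rewrite {1}ego raddfD /= coeftS_tM.
have -> : coeft m.+1 ge' = coeft m go' + 'X * coeft m go.
  by rewrite {1}ege raddfD /= coeft_yM !coeftS_tM.
rewrite IHo IHe (oe m.+1).1 (oe m).1.
rewrite (@colour_gf_rcons s a m (odd m.+1)) //; last first.
  move=> b s' /[dup] /asc ba es; case: ifP => _; first by rewrite ba.
  by rewrite ltnNge (ltnW ba).
rewrite /wt /=; case: (odd m) => /=; rewrite ?mulr0 ?addr0 ?addn0 //.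
by rewrite addn1 mul1r.
Qed.

(** After a descent the sharing is reversed: only an even new colour can be shared, so [ge] takes
    the place of [go]. *)
Lemma odd_even_parts_desc s a go ge go' ge' : uniq (rcons s a) ->
  (0 < size s)%N -> (forall b s', s = rcons s' b -> (a < b)%N) ->
  odd_even_parts s go ge ->
  go' = t * ge' + t * ge -> ge' = t * go' + y * ge ->
  odd_even_parts (rcons s a) go' ge'.
Proof.
move=> us s0 dsc oe ego ege m.
have G0 : colour_gf (rcons s a) 0 = 0 by rewrite colour_gf0 // size_rcons.
elim: m => [|m [IHo IHe]].
  split; [rewrite {1}ego|rewrite {1}ege]; rewrite raddfD /= ?coeft_yM !coeft0_tM /= ?G0.
    by rewrite addr0.
  by rewrite (oe 0%N).2 /= colour_gf0 // mulr0 addr0.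
have -> : coeft m.+1 go' = coeft m ge' + coeft m ge.
  by rewrite {1}ego raddfD /= !coeftS_tM.
have -> : coeft m.+1 ge' = coeft m go' + 'X * coeft m.+1 ge.
  by rewrite {1}ege raddfD /= coeft_yM !coeftS_tM.
rewrite IHo IHe (oe m.+1).2 (oe m).2.
rewrite (@colour_gf_rcons s a m (~~ odd m.+1)) //; last first.
  move=> b s' /[dup] /dsc ba es; case: ifP => _; last by rewrite ba.
  by rewrite ltnNge (ltnW ba).
rewrite /wt /=; case: (odd m) => /=; rewrite ?mulr0 ?addr0 ?addn0 ?mul1r //.
by rewrite addn1.
Qed.

(** * Closed forms of the two parts *)

Definition core (n u d : nat) : {poly fps} :=
  t ^+ u * (1 + y) ^+ (u - 1) * (1 + y * t ^+ 2) ^+ (n - d - uphalf u)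
  * (y + t ^+ 2) ^+ (d - u./2).

Definition base (n u d : nat) : {poly fps} := inv1t2 ^+ n.+1 * core n u d.

(** Apart from t^u, all factors of [base] are even in t, so the prefactor fixes the parity of the
    degrees. *)
Definition odd_part (n u d : nat) :=
  (if odd u then 1 + y * t ^+ 2 else t * (1 + y)) * base n u d.

Definition even_part (n u d : nat) :=
  (if odd u then t * (1 + y) else y + t ^+ 2) * base n u d.

(** Solving the recursion for an appended letter divides one of the two parts by 1 - t^2. The parity
    of [u] and the flag [e] decide which exponents of [core] grow; admissibility keeps the truncated
    subtractions exact. *)
Lemma base_next n u d (e : bool) : admissible n.+1 (u, d) ->
  (1 - t ^+ 2) * base n.+2 (u + (odd u == e)) (d + e) =
  (if e then even_part else odd_part) n.+1 u d.
Proof.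
rewrite /admissible /= xpair_eqE /= => adm.
have -> : (1 - t ^+ 2) * base n.+2 (u + (odd u == e)) (d + e) =
    inv1t2 ^+ n.+2 * core n.+2 (u + (odd u == e)) (d + e).
  by rewrite /base exprS !mulrA inv1t2K mul1r.
have u0 : (0 < u)%N by lia.
rewrite /odd_part /even_part /base /core.
case: e (boolP (odd u)) => -[] ou /=.
- have -> : (n.+2 - (d + true) - uphalf (u + true) = n.+1 - d - uphalf u)%N by lia.
  have -> : (d + true - (u + true)./2 = d - u./2)%N by lia.
  have -> : (u + true - 1 = (u - 1).+1)%N by lia.
  by rewrite addn1 !exprS; ring.
- have -> : (n.+2 - (d + true) - uphalf (u + false) = n.+1 - d - uphalf u)%N by lia.
  have -> : (d + true - (u + false)./2 = (d - u./2).+1)%N by lia.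
  by rewrite addn0 !exprS; ring.
- have -> : (n.+2 - (d + false) - uphalf (u + false) = (n.+1 - d - uphalf u).+1)%N by lia.
  by rewrite !addn0 !exprS; ring.
have -> : (n.+2 - (d + false) - uphalf (u + true) = n.+1 - d - uphalf u)%N by lia.
have -> : (d + false - (u + true)./2 = d - u./2)%N by lia.
have -> : (u + true - 1 = (u - 1).+1)%N by lia.
by rewrite addn1 !exprS; ring.
Qed.

Lemma coeft_const1t m : coeft m ((1 - ft)^-1)%:P = 1.
Proof.
have -> : (1 - ft)^-1 = Fps (fun=> 1).
  have u1 : 1 - ft \is a GRing.unit by have := unit_1BtX 0.
  apply: (mulrI u1); rewrite mulrV // -[LHS](geometric_series 0) expr1.
  congr (_ * _).
  by apply: FpsRing.fpsP => n /=; rewrite dvd1n.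
by rewrite /coeft map_polyC.
Qed.

(** The empty word has one colouring for every [m], and 1/(1-t) = (1+t)/(1-t^2). *)
Lemma odd_even_parts_nil : odd_even_parts [::] (t * inv1t2) inv1t2.
Proof.
suff H m : coeft m inv1t2 = if odd m then 0 else 1.
  case=> [|m]; rewrite ?coeft0_tM ?coeftS_tM !H !colour_gf_nil //=.
  by case: odd.
have e : inv1t2 = 1 + t ^+ 2 * inv1t2 by rewrite -[X in X + _]inv1t2K; ring.
elim/ltn_ind: m => -[|[|m]] IH; rewrite e raddfD /= coeft_tXM /=.
- by rewrite addr0 rmorph1.
- by rewrite addr0 /coeft map_polyC /= polyC0.
by rewrite !subSS subn0 IH // negbK /coeft map_polyC /= polyC0 add0r.
Qed.

(** The analogue of [base_next] for the step from the empty word, whose odd part is [t * inv1t2]. *)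
Lemma base1 : (1 - t ^+ 2) * base 1 1 0 = t * inv1t2.
Proof.
rewrite /base /core /= !expr0 expr1 !mulr1 exprS mulrA (mulrA _ inv1t2) inv1t2K.
by ring.
Qed.

Lemma odd_even_parts_udr_des s : uniq s -> (0 < size s)%N ->
  odd_even_parts s (odd_part (size s) (udr s) (des s))
                   (even_part (size s) (udr s) (des s)).
Proof.
elim/last_ind: s => [|s a IHs] // us _.
case/lastP: s => [|s b] in us IHs *.
  apply: odd_even_parts_asc us _ odd_even_parts_nil _ _.
  - by move=> ? [].
  - by rewrite udr1 des1 /odd_part /even_part /= -base1; ring.
  - by rewrite udr1 des1 /odd_part /even_part /= -base1; ring.
have us1 : uniq (rcons s b) by move: us; rewrite rcons_uniq => /andP[].
have {}IHs := IHs us1; rewrite !size_rcons /= in IHs.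
have adm := admissible_udr_des us1; rewrite size_rcons in adm.
rewrite udr_rcons2 // des_rcons2 // !size_rcons.
set u := udr _ in IHs adm *; set d := des _ in IHs adm *.
have e_b c s' : rcons s b = rcons s' c -> b = c by move=> /rcons_inj[].
have ab : a != b.
  by apply/eqP=> ab; move: us; rewrite ab rcons_uniq mem_rcons mem_head.
have bn := base_next (a < b)%N adm.
(* The new [udr] is odd exactly when the last step is an ascent, which selects the branch of the
   closed forms. *)
have odd_next : odd (u + (odd u == (a < b)%N)) = ~~ (a < b)%N.
  by rewrite oddD oddb; case: (odd u) (a < b)%N => [] [].
rewrite /odd_part /even_part odd_next.
case: (boolP (a < b)%N) => alb in bn *.
- apply: odd_even_parts_desc us _ _ (IHs isT) _ _; rewrite -?bn ?size_rcons //=.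
  + by move=> c s' /e_b <-.
  + by ring.
  + by ring.
have bla : (b < a)%N by rewrite ltn_neqAle eq_sym ab leqNgt.
apply: odd_even_parts_asc us _ (IHs isT) _ _; rewrite -?bn //=.
- by move=> c s' /e_b <-.
- by ring.
- by ring.
Qed.

Definition genfun (n : nat) (x : nat * nat) : {poly fps} :=
  if n == 0%N then (inv_denominator 0)%:P
  else inv_denominator n *: numerator n x.1 x.2.

Lemma unit_denominator n : (1 - ft) * (1 - ft ^+ 2) ^+ n \is a GRing.unit.
Proof.
by rewrite unitrM unitrX ?unit_1BtX // andbT; have := unit_1BtX 0; rewrite expr1.
Qed.

Lemma numeratorE n u d :
  numerator n u d = core n u d * (if odd u then 1 + y * t else y + t).
Proof.
rewrite /numerator -/(core n u d) -mulrA; congr (_ * _).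
case: ifP => ou.
  have -> : (uphalf u - u./2 = 1)%N by lia.
  have -> : (1 + u./2 - uphalf u = 0)%N by lia.
  by rewrite mulr1.
have -> : (uphalf u - u./2 = 0)%N by lia.
have -> : (1 + u./2 - uphalf u = 1)%N by lia.
by rewrite mul1r.
Qed.

(** The prefactors add up to (1+t)(1+yt) for odd u and to (1+t)(y+t) for even u; the factor 1+t
    turns one 1-t^2 of the denominator into 1-t. *)
Lemma genfunE n u d : (0 < n)%N ->
  genfun n (u, d) = odd_part n u d + even_part n u d.
Proof.
rewrite /genfun lt0n => /negPf-> /=.
have cancel : numerator n u d = ((1 - ft) * (1 - ft ^+ 2) ^+ n)%:P *
    (odd_part n u d + even_part n u d).
  have inv1 : (1 - t ^+ 2) ^+ n.+1 * inv1t2 ^+ n.+1 = 1.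
    by rewrite -exprMn inv1t2K expr1n.
  rewrite numeratorE /odd_part /even_part /base.
  rewrite polyCM !(polyC_exp, polyCB, polyC1).
  rewrite -[LHS]mul1r -[X in X * _ = _]inv1 [(1 - t ^+ 2) ^+ n.+1]exprS.
  by case: odd; ring.
rewrite cancel -mul_polyC mulrA -polyCM /inv_denominator.
by rewrite mulVr ?unit_denominator // mul1r.
Qed.

Lemma inv_denominator0 : inv_denominator 0 = (1 - ft)^-1.
Proof. by rewrite /inv_denominator expr0 mulr1. Qed.

Lemma coeft_genfun s m : uniq s ->
  coeft m (genfun (size s) (udr s, des s)) = colour_gf s m.
Proof.
move=> us; have [/size0nil->|s0] := posnP (size s).
  by rewrite /genfun /= inv_denominator0 coeft_const1t colour_gf_nil.
rewrite genfunE // raddfD /=.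
have [-> ->] := odd_even_parts_udr_des us s0 m.
by case: odd; rewrite ?addr0 ?add0r.
Qed.

Lemma class_imageE p :
  class_image p = monomial_x (genfun (size p) (udr_des p)) (size p).
Proof. by rewrite /class_image /genfun; case: eqP => [->|]. Qed.

(** * Lowest terms in t and linear independence *)

Definition lead_expn (n u d : nat) : nat :=
  if n == 0%N then 0 else (d - u./2 + ~~ odd u)%N.

Lemma lead_expn_inj n u d d' : admissible n (u, d) -> admissible n (u, d') ->
  lead_expn n u d = lead_expn n u d' -> d = d'.
Proof.
rewrite /admissible /lead_expn; case: n => [|n] /=; rewrite !xpair_eqE /=; lia.
Qed.

Lemma coeft0_y : coeft 0 y = 'X.
Proof. exact: map_polyX. Qed.

Lemma coeft0_polyC f : coeft 0 f%:P = (fcoef_at 0 f)%:P.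
Proof. exact: map_polyC. Qed.

Lemma coeft0_t : coeft 0 t = 0.
Proof. by rewrite coeft0_polyC polyC0. Qed.

Lemma fcoef_at0_inv_denominator n : fcoef_at 0 (inv_denominator n) = 1.
Proof.
have := congr1 (fcoef_at 0) (mulVr (unit_denominator n)).
rewrite !(rmorphM, rmorphXn, rmorphB, rmorph1) /=.
by rewrite mulr0 subr0 expr1n !mulr1.
Qed.

(** All factors except t^u are evaluated at t = 0. Then y + t^2 becomes y, as does y + t, which is
    present only for even u; the inverse denominator has constant term 1. *)
Lemma coeft_genfun_lead n u d : admissible n (u, d) ->
  coeft u (genfun n (u, d)) = (1 + 'X) ^+ (u - 1) * 'X^(lead_expn n u d).
Proof.
rewrite /genfun /lead_expn; case: eqP => [->|/eqP n0] adm.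
  have -> : u = 0%N by move: adm; rewrite /admissible /= xpair_eqE => /andP[/eqP].
  by rewrite inv_denominator0 coeft_const1t mulr1.
rewrite numeratorE -mul_polyC /core /= -!mulrA mulrCA coeft_tXM ltnn subnn.
rewrite !rmorphM /= !rmorphXn /= !rmorphD /= !rmorphM rmorph1 /=.
rewrite coeft0_y coeft0_t !mulr0 !addr0 expr1n mul1r.
rewrite coeft0_polyC fcoef_at0_inv_denominator mul1r exprD.
by do 2!congr (_ * _); case: odd;
   rewrite rmorphD ?rmorphM ?rmorph1 /= coeft0_t coeft0_y ?mulr0 addr0.
Qed.

Lemma coeft_genfun_lt n u d m : admissible n (u, d) -> (m < u)%N ->
  coeft m (genfun n (u, d)) = 0.
Proof.
rewrite /genfun; case: eqP => [->|/eqP n0] adm mu.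
  by move: adm; rewrite /admissible /= xpair_eqE; lia.
by rewrite numeratorE -mul_polyC /core /= -!mulrA mulrCA coeft_tXM mu.
Qed.

(* The lowest term in [t] of [genfun n (u, d)] has degree [u], and for a given
   [u] these lowest terms are (1+y)^(u-1) times distinct powers of [y]. *)
Lemma genfun_free (I : eqType) (n : nat) (s : seq I) (e : I -> nat * nat)
    (c : I -> rat) : uniq s -> {in s &, injective e} ->
  (forall i, i \in s -> admissible n (e i)) ->
  (forall m, \sum_(i <- s) c i *: coeft m (genfun n (e i)) = 0) ->
  forall i, i \in s -> c i = 0.
Proof.
move=> us inj_e adm rel.
suff H u i : i \in s -> (e i).1 = u -> c i = 0 by move=> i /H; apply.
(* In the coefficient of t^u, smaller first entries drop out by induction and larger ones contribute
   nothing. *)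
elim/ltn_ind: u i => u IHu i0 i0s i0u.
pose a i := lead_expn n u (e i).2.
have sum0 : \sum_(i <- s | (e i).1 == u) c i *: 'X^(a i) = 0 :> {poly rat}.
  have X1 : (1 + 'X) ^+ (u - 1) != 0 :> {poly rat}.
    by rewrite expf_neq0 // addrC monic_neq0 // monicXaddC.
  apply: (mulfI X1); rewrite mulr0; apply: etrans (rel u).
  rewrite mulr_sumr big_mkcond.
  apply: eq_big_seq => i si; have := adm i si.
  case E : (e i) => [v d] /= admi.
  have [vu|uv|vu] := ltngtP v u.
  - by rewrite (IHu v) ?E // scale0r.
  - by rewrite coeft_genfun_lt // scaler0.
  rewrite vu in admi E *.
  by rewrite coeft_genfun_lead // /a E -scalerAr.
(* The factor (1+y)^(u-1) is gone and the remaining exponents are distinct, so one power of y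
   isolates [c i0]. *)
have := congr1 (fun p : {poly rat} => p`_(a i0)) sum0.
rewrite coef0 coef_sum big_mkcond (bigD1_seq i0) //= i0u eqxx coefZ coefXn eqxx.
rewrite mulr1 big_seq_cond big1 ?addr0 // => i /andP[si ne].
case: eqP => // iu; rewrite coefZ coefXn; case: eqP => [ea|]; last by rewrite mulr0.
case/eqP: ne; apply: inj_e => //.
have := adm _ si; have := adm _ i0s; move: ea iu i0u; rewrite /a.
case: (e i) (e i0) => [u1 d1] [u2 d2] /= ea -> -> adm1 adm2.
by rewrite (lead_expn_inj adm1 adm2 ea).
Qed.

(** * The shuffle algebra *)

Local Open Scope classical_set_scope.
Local Open Scope ring_scope.

Definition eval_at (m : nat) (f : nat -> rat) : rat := f m.

Lemma eval_at_is_zmod_morphism m : zmod_morphism (eval_at m).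
Proof. by []. Qed.

(** Valid for every [m], since the Hadamard product acts coefficient by coefficient; for the
    ordinary product only [m = 0] works. *)
Lemma eval_at_is_monoid_morphism m : monoid_morphism (eval_at m).
Proof. by []. Qed.

HB.instance Definition _ m := GRing.isZmodMorphism.Build (nat -> rat) rat
  (eval_at m) (eval_at_is_zmod_morphism m).
HB.instance Definition _ m := GRing.isMonoidMorphism.Build (nat -> rat) rat
  (eval_at m) (eval_at_is_monoid_morphism m).

(* The coefficient of [x^n t^m]. *)
Definition hcoef (n m : nat) (p : hadamard_xy) : {poly rat} :=
  map_poly (eval_at m) p`_n.

Lemma hcoef_is_linear n m : linear (hcoef n m).
Proof.
move=> a p q; apply/polyP=> i.
rewrite coefD coefZ !coef_map /= coefD.
rewrite [a *: p]/(((cst a : nat -> rat)%:P)%:P * p) coefCM.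
by rewrite coefD coefCM.
Qed.

HB.instance Definition _ n m := GRing.isLinear.Build rat hadamard_xy {poly rat} *:%R
  (hcoef n m) (hcoef_is_linear n m).

Lemma hcoef_inj p q : (forall n m, hcoef n m p = hcoef n m q) -> p = q.
Proof.
move=> pq; apply/polyP=> n; apply/polyP=> i; apply/funext=> m.
have := congr1 (fun r : {poly rat} => r`_i) (pq n m).
by rewrite !coef_map.
Qed.

Lemma eval_map_fcoef m f : map_poly (eval_at m) (map_poly fcoef f) = coeft m f.
Proof. by apply/polyP=> i; rewrite coef_map /= coef_map_id0 // coef_coeft. Qed.

Lemma hcoef_polyCXn (c : {poly (nat -> rat)}) k n m :
  hcoef n m (c%:P * 'X^k) = if n == k then map_poly (eval_at m) c else 0.
Proof.
rewrite /hcoef coefCM coefXn; case: eqP => _; first by rewrite mulr1.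
by rewrite mulr0 rmorph0.
Qed.

Lemma hcoef_monomial f k n m :
  hcoef n m (monomial_x f k) = if n == k then coeft m f else 0.
Proof. by rewrite hcoef_polyCXn eval_map_fcoef. Qed.

Lemma hcoef_monomialM f k g l n m :
  hcoef n m (monomial_x f k * monomial_x g l) =
  if n == (k + l)%N then coeft m f * coeft m g else 0.
Proof.
rewrite [monomial_x f k * _]mulrACA -exprD -polyCM hcoef_polyCXn.
by rewrite rmorphM /= !eval_map_fcoef.
Qed.

Lemma hcoef_class_image (p : permutation) n m :
  hcoef n m (class_image p) = if n == size p then colour_gf p m else 0.
Proof.
by rewrite class_imageE hcoef_monomial coeft_genfun // perm_uniq_letters.
Qed.

(** At x^n t^m both sides involve [colour_gf] at the same [m], so this is [colour_gf_shuffle]. *)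
Lemma class_imageM (p q : permutation) : disjoint_perms p q ->
  class_image p * class_image q = \sum_(r <- shuffles p q) class_image r.
Proof.
move=> pq; apply: hcoef_inj => n m.
rewrite linear_sum !class_imageE hcoef_monomialM !coeft_genfun ?perm_uniq_letters //.
rewrite colour_gf_shuffle //; case: eqP => [->|npq].
  apply: eq_big_seq => r /size_shuffle sr.
  by rewrite /= hcoef_class_image sr eqxx.
rewrite big_seq big1 // => r /size_shuffle sr.
by rewrite /= hcoef_class_image sr; case: eqP.
Qed.

Lemma class_image_empty : class_image empty_perm = 1.
Proof.
apply: hcoef_inj => n m; rewrite hcoef_class_image /= colour_gf_nil /hcoef coef1.
by case: eqP => _; rewrite ?rmorph1 ?rmorph0.
Qed.

Lemma eq_class_image (p q : permutation) : size p = size q ->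
  udr_des p = udr_des q -> class_image p = class_image q.
Proof. by rewrite !class_imageE => -> ->. Qed.

Lemma admissible_perm (p : permutation) : admissible (size p) (udr_des p).
Proof. exact/admissible_udr_des/perm_uniq_letters. Qed.

(** The multiplicities of the values over the shuffles are the coefficients of a combination of
    generating functions equal to the product of two images. This product depends only on the
    classes, and independence recovers the multiplicities. *)
Lemma udr_des_shuffle_compatible : shuffle_compatible udr_des.
Proof.
move=> p q p' q' pq pq' sp sq stp stq.
set L1 := [seq _ | _ <- _]; set L2 := [seq _ | _ <- _].
pose n := (size p + size q)%N.
have admL x : x \in L1 ++ L2 -> admissible n x.
  rewrite mem_cat => /orP[] /mapP[r /size_shuffle sr ->].
    by rewrite /n -sr admissible_perm.
  by rewrite /n sp sq -sr admissible_perm.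
have sumE (a b : permutation) m : disjoint_perms a b -> (size a + size b)%N = n ->
    \sum_(x <- [seq udr_des r | r <- shuffles a b]) coeft m (genfun n x) =
    hcoef n m (class_image a * class_image b).
  move=> ab nab; rewrite class_imageM // linear_sum big_map.
  apply: eq_big_seq => r /size_shuffle sr.
  by rewrite /= class_imageE hcoef_monomial sr nab eqxx.
pose S := undup (L1 ++ L2).
have countE L m : {subset L <= S} ->
    \sum_(x <- L) coeft m (genfun n x) =
    \sum_(x <- S) (count_mem x L)%:R *: coeft m (genfun n x).
  elim: L => [|z L IHL] LS.
    by rewrite big_nil big1 // => x _; rewrite scale0r.
  have zS : z \in S by apply: LS; apply: mem_head.
  rewrite big_cons IHL => [|x xL]; last by apply: LS; rewrite inE xL orbT.
  under [RHS]eq_bigr do rewrite /= natrD scalerDl.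
  rewrite big_split [X in _ = X + _](bigD1_seq z) ?undup_uniq //= eqxx scale1r.
  congr (_ + _).
  rewrite big1 ?addr0 // => x /negPf.
  by rewrite eq_sym => ->; rewrite scale0r.
(* [perm_eq] unfolds to equal multiplicities for the members of [L1 ++ L2]. *)
apply/allP => x; rewrite -mem_undup => xS /=.
pose c x : rat := (count_mem x L1)%:R - (count_mem x L2)%:R.
have : c x = 0.
  apply: (@genfun_free _ n S id) xS => [|? ? ? ? //|i|m].
  - exact: undup_uniq.
  - by rewrite mem_undup; apply: admL.
  under eq_bigr do rewrite scalerBl.
  rewrite sumrB -!countE; [|by move=> i iL; rewrite mem_undup mem_cat iL ?orbT..].
  rewrite !sumE // -?sp -?sq // (eq_class_image sp stp) (eq_class_image sq stq).
  by rewrite subrr.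
by move/eqP; rewrite subr_eq0 Num.Theory.eqr_nat.
Qed.

(** * The algebra morphism and its injectivity *)

Section Isomorphism.
Variable sc : shuffle_compatible udr_des.
Local Notation A := (shuffle_algebra sc).

Definition phi (g : A) : hadamard_xy :=
  lin_ext (fun c : st_class udr_des => class_image (class_repr c)) g.

Lemma phi_is_linear : linear phi.
Proof. exact: lin_ext_is_linear. Qed.

Lemma phi_class p : phi (perm_class sc p) = class_image p.
Proof.
rewrite /phi /perm_class lin_extU.
by have [sp tp] := class_repr_of udr_des p; apply: eq_class_image.
Qed.

HB.instance Definition _ :=
  GRing.isLinear.Build rat A hadamard_xy *:%R phi phi_is_linear.

Lemma linear_perm_class_ext (V : lmodType rat) (F G : A -> V) :
  linear F -> linear G ->
  (forall p, F (perm_class sc p) = G (perm_class sc p)) -> F =1 G.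
Proof.
move=> lF lG FG; apply: (malg_ext lF lG) => k.
by have := FG (class_repr k); rewrite /perm_class class_reprK.
Qed.

Lemma perm_class_raise m q : perm_class sc (raise m q) = perm_class sc q.
Proof. by rewrite /perm_class class_raise. Qed.

Lemma phi_is_monoid_morphism : monoid_morphism phi.
Proof.
split; first by rewrite -class_image_empty -phi_class.
move=> g h; move: g; apply: linear_perm_class_ext => [a u v|a u v|p].
- by rewrite mulrDl -scalerAl linearP.
- by rewrite linearP mulrDl -scalerAl.
move: h; apply: linear_perm_class_ext => [a u v|a u v|q].
- by rewrite mulrDr -scalerAr linearP.
- by rewrite linearP mulrDr -scalerAr.
(* Raising the letters of [q] keeps its class and makes the product a sum over shuffles. *)
have pq : disjoint_perms p (raise (max_letter p) q).
  by apply: raise_disjoint => x; apply: max_letterP.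
rewrite -(perm_class_raise (max_letter p) q) perm_classM // linear_sum.
rewrite !phi_class class_imageM //; apply: eq_bigr => r _.
exact: phi_class.
Qed.

HB.instance Definition _ :=
  GRing.isMonoidMorphism.Build A hadamard_xy phi phi_is_monoid_morphism.

(** Extracting x^n keeps the classes of length n, which [udr_des] distinguishes, so [genfun_free]
    kills their coefficients. *)
Lemma phi_inj : injective phi.
Proof.
apply: raddf_inj => g pg.
apply/malgP=> k; rewrite mcoeff0.
have [kg|] := boolP (k \in msupp g); last exact: mcoeff_outdom.
pose n := size (class_repr k).
pose s := [seq c <- msupp g | size (class_repr c) == n].
apply: (@genfun_free _ n s (fun c => udr_des (class_repr c)) (fun c => g@_c)).
- by rewrite filter_uniq // fset_uniq.
- move=> c c'; rewrite !mem_filter => /andP[/eqP sc1 _] /andP[/eqP sc2 _] e.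
  by rewrite -(class_reprK c) -(class_reprK c'); apply/class_ofP; rewrite sc1 sc2.
- by move=> c; rewrite mem_filter => /andP[/eqP<- _]; apply: admissible_perm.
- move=> m; rewrite big_filter big_mkcond.
  have := congr1 (hcoef n m) pg; rewrite linear0; apply: etrans.
  rewrite /phi /lin_ext linear_sum; apply: eq_bigr => c _.
  rewrite linearZ /= class_imageE hcoef_monomial eq_sym.
  by case: eqP => [->|]; rewrite ?scaler0.
by rewrite mem_filter eqxx.
Qed.

End Isomorphism.

(** * The span of the images *)

Lemma generatorsE : generators = range class_image.
Proof.
apply/seteqP; split=> [f|_ [p _ <-]].
  (* Each generator belongs to an admissible pair, which some permutation realizes; the first two
     families are the pairs (0, 0) and (1, 0). *)
  have of_adm n x f' : admissible n x -> f' = monomial_x (genfun n x) n ->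
      range class_image f'.
    move=> /admissible_realized[p <- <-] ->; exists p => //.
    by rewrite class_imageE.
  case=> [[->|[n n1 ->]]|[n [j [k [n1 jn kn ->]]]]].
  - by apply: (of_adm 0%N (0, 0)%N).
  - apply: (of_adm n (1, 0)%N); first by case: (n) n1.
    rewrite /genfun -[n == 0%N]negbK -lt0n n1.
    rewrite /= numeratorE /core /= expr1 !expr0 !mulr1; congr (monomial_x (_ *: _) n).
    by rewrite subn0; ring.
  apply: (of_adm n (j, k)).
    by rewrite /admissible xpair_eqE /=; case: ifP; lia.
  rewrite /genfun -[n == 0%N]negbK -lt0n n1 /= numeratorE /core /S_factor.
  by rewrite subnAC.
rewrite class_imageE; have := admissible_perm p.
case: (udr_des p) => [u d]; rewrite /admissible /genfun.
case: eqP => [->|/eqP n0]; first by move=> _; left; left.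
rewrite -lt0n in n0.
case/orP=> [/eqP[-> ->]|/and3P[/= u2 du dn]].
  left; right; exists (size p) => //.
  rewrite numeratorE /core /= expr1 !expr0 !mulr1 subn0; congr (monomial_x (_ *: _) _).
  by ring.
right; exists (size p), u, d; split=> //; [lia..|].
by rewrite numeratorE /core /S_factor.
Qed.

Lemma range_phi (sc : shuffle_compatible udr_des) :
  range (phi (sc := sc)) = lin_span generators.
Proof.
rewrite generatorsE; apply/seteqP; split=> [_ [g _ <-]|f [s [sP ->]]].
  exists [seq (g@_c, class_image (class_repr c)) | c <- msupp g]; split.
    by move=> _ /mapP[c _ ->]; exists (class_repr c).
  by rewrite big_map.
elim: s sP => [|[a v] s IHs] sP.
  by exists 0; rewrite ?linear0 ?big_nil.
have [|g _ eg] := IHs; first by move=> x xs; apply: sP; rewrite inE xs orbT.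
have [p _ /= ep] := sP _ (mem_head _ _).
exists (a *: perm_class sc p + g) => //.
by rewrite big_cons -eg linearP /= phi_class ep.
Qed.

(** The span is the range of an algebra morphism. *)
Lemma subalg_closed_generators (sc : shuffle_compatible udr_des) :
  GRing.subalg_closed [in lin_span generators].
Proof.
rewrite -(range_phi sc); split.
- by rewrite inE; exists 1; rewrite ?rmorph1.
- move=> a u v; rewrite !inE => -[g _ <-] [h _ <-].
  by exists (a *: g + h); rewrite ?linearP.
- move=> u v; rewrite !inE => -[g _ <-] [h _ <-].
  by exists (g * h); rewrite ?rmorphM.
Qed.

(** * Dimension count *)

Definition admissible_pairs (n : nat) : seq (nat * nat) :=
  if n == 0%N then [:: (0, 0)%N]
  else (1, 0)%N :: [seq (j, k) | j <- iota 2 (n - 1), k <- iota j./2 (n.+1 - j)].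

Lemma mem_admissible_pairs n x : (x \in admissible_pairs n) = admissible n x.
Proof.
rewrite /admissible_pairs /admissible; case: eqP => [_|n0]; first by rewrite inE.
rewrite inE; congr orb; case: x => [u d] /=.
apply/allpairsPdep/idP => [[j [k [+ + [-> ->]]]]|H].
  by rewrite !mem_iota; lia.
by exists u, d; rewrite !mem_iota; split=> //; lia.
Qed.

Lemma admissible_pairs_uniq n : uniq (admissible_pairs n).
Proof.
rewrite /admissible_pairs; case: eqP => //= _.
apply/andP; split.
  by apply/allpairsPdep=> -[j [k [+ _ [ej _]]]]; rewrite -ej mem_iota.
apply: allpairs_uniq_dep; first exact: iota_uniq.
  by move=> j _; exact: iota_uniq.
by move=> _ _ /allpairsPdep[j [k [_ _ ->]]] /allpairsPdep[j' [k' [_ _ ->]]] [-> ->].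
Qed.

(** For n at least 1, each j from 2 to n allows n + 1 - j values of k, which sum to n(n-1)/2; the
    pair (1, 0) adds one. *)
Lemma size_admissible_pairs n : size (admissible_pairs n) = ('C(n, 2) + 1)%N.
Proof.
rewrite /admissible_pairs; case: n => [|n] //=.
rewrite size_allpairs_dep addn1 subn1 /=; congr S.
under eq_map do rewrite size_iota.
rewrite sumnE big_map (iotaDl 2 0 n) big_map -[n in iota 0 n]subn0.
rewrite -/(index_iota 0 n) big_mkord -bin2_sum big_mkord.
(* The zero term of the sum for the binomial is dropped and the order of summation reversed. *)
rewrite big_ord_recl add0n (reindex_inj rev_ord_inj) /=.
by apply: eq_bigr => i _; have := ltn_ord i; rewrite /bump; lia.
Qed.

(** One permutation is chosen per admissible pair; their classes are distinct basis elements and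
    exhaust the classes of length n. *)
Lemma homogeneous_dimension (sc : shuffle_compatible udr_des) n :
  has_dimension (homogeneous_component sc n) ('C(n, 2) + 1).
Proof.
rewrite -size_admissible_pairs.
have real (i : 'I_(size (admissible_pairs n))) : exists p : permutation,
    size p = n /\ udr_des p = nth (0, 0)%N (admissible_pairs n) i.
  have /admissible_realized[p pn pe] :
      admissible n (nth (0, 0)%N (admissible_pairs n) i).
    by rewrite -mem_admissible_pairs mem_nth.
  by exists p.
have [P PP] := choice real.
exists (fun i => perm_class sc (P i)); split=> [c sum0 i|].
  have := congr1 (mcoeff (class_of udr_des (P i))) sum0.
  rewrite mcoeff0 raddf_sum /= (bigD1 i) //= big1 ?addr0.
    by rewrite mcoeffZ mcoeffUU mulr1.
  move=> j ji; rewrite mcoeffZ mcoeffU; case: eqP; rewrite ?mulr0 //.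
  move/class_ofP=> [_]; rewrite (PP i).2 (PP j).2 => /eqP.
  by rewrite nth_uniq ?admissible_pairs_uniq // => /eqP/val_inj e; rewrite e eqxx in ji.
congr (lin_span _); apply/seteqP; split=> [_ [p /= pn <-]|_ [i _ <-]]; last first.
  by exists (P i) => //; case: (PP i).
have : udr_des p \in admissible_pairs n.
  by rewrite mem_admissible_pairs -pn admissible_perm.
move=> /[dup] pa; rewrite -index_mem => lt_i.
exists (Ordinal lt_i) => //; rewrite /perm_class; congr (<< _ >>).
by apply/class_ofP; have [-> ->] := PP (Ordinal lt_i); rewrite /= nth_index.
Qed.

Theorem theorem5p11 :
  shuffle_compatible udr_des /\
  forall sc : shuffle_compatible udr_des,
    [/\ exists phi : {lrmorphism shuffle_algebra sc -> hadamard_xy},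
          [/\ forall p : permutation, phi (perm_class sc p) = class_image p,
              injective phi &
              range phi = lin_span generators],
        GRing.subalg_closed [in lin_span generators] &
        forall n : nat,
          has_dimension (homogeneous_component sc n) ('C(n, 2) + 1)%N].
Proof.
split=> [|sc]; first exact: udr_des_shuffle_compatible.
split; last exact: homogeneous_dimension.
  exists (phi (sc := sc)); split; [exact: phi_class | exact: phi_inj | exact: range_phi].
exact: subalg_closed_generators sc.
Qed.
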